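(* Let $n\ge2$ and let $V_1,\dots,V_n$ be independent random variables uniformly distributed on $[0,1]$. A function $C:[0,1]^n\to[0,1]$ is an absolutely continuous $n$-dimensional copula if and only if there exist Borel measurable functions $\tilde g_{i_1,\dots,i_c}:\mathbf R^c\to\mathbf R$, $1\le i_1<\dots<i_c\le n$, $c=2,\dots,n$, such that (A4) $\int_0^1\cdots\int_0^1|\tilde g_{i_1,\dots,i_c}(t_{i_1},\dots,t_{i_c})|\,dt_{i_1}\cdots dt_{i_c}<\infty$ for all $1\le i_1<\dots<i_c\le n$, $c=2,\dots,n$; (A5) for all $1\le i_1<\dots<i_c\le n$, $c=2,\dots,n$, and $k=1,\dots,c$, $$E\big(\tilde g_{i_1,\dots,i_c}(V_{i_1},\dots,V_{i_c})\,\big|\,V_{i_1},\dots,V_{i_{k-1}},V_{i_{k+1}},\dots,V_{i_c}\big)=\int_0^1\tilde g_{i_1,\dots,i_c}(V_{i_1},\dots,V_{i_{k-1}},t,V_{i_{k+1}},\dots,V_{i_c})\,dt=0\quad\text{(a.s.)};$$ (A6) $\tilde U_n(V_1,\dots,V_n)\ge-1$ (a.s.), where $\tilde U_n(t_1,\dots,t_n)=\sum_{c=2}^n\sum_{1\le i_1<\dots<i_c\le n}\tilde g_{i_1,\dots,i_c}(t_{i_1},\dots,t_{i_c})$; and such that for all $(u_1,\dots,u_n)\in[0,1]^n$ $$C(u_1,\dots,u_n)=\int_0^{u_1}\cdots\int_0^{u_n}\big(1+\tilde U_n(t_1,\dots,t_n)\big)\prod_{i=1}^ndt_i.$$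
   Context: An $n$-dimensional copula is a function $C:[0,1]^n\to[0,1]$ which is the joint cdf (restricted to $[0,1]^n$) of $n$ random variables each uniformly distributed on $[0,1]$. A copula is called absolutely continuous if, considered as a joint cdf, it has a joint density (with respect to Lebesgue measure), given by $\partial^nC(u_1,\dots,u_n)/\partial u_1\cdots\partial u_n$. *)

(* Defs.v *)
From HB Require Import structures.
From mathcomp Require Import all_boot all_order all_algebra.
From mathcomp Require Import all_classical all_reals all_analysis.
From mathcomp Require Import measurable_realfun.

Set Implicit Arguments.
Unset Strict Implicit.
Unset Printing Implicit Defensive.

Import Order.TTheory GRing.Theory Num.Theory.
Import numFieldNormedType.Exports.

Local Open Scope classical_set_scope.
Local Open Scope ring_scope.

Section lebesgue_measure_cons.
Context {R : realType} {n : nat}.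
Variable mu : {sigma_finite_measure set (n.-tuple R) -> \bar R}.

Definition tuple_cons (p : R * n.-tuple R) : n.+1.-tuple R :=
  [tuple of p.1 :: p.2].

Lemma measurable_tuple_cons : measurable_fun [set: R * n.-tuple R] tuple_cons.
Proof. exact: (measurable_cons measurable_fst measurable_snd). Qed.

Definition lebesgue_cons : set (n.+1.-tuple R) -> \bar R :=
  pushforward (product_measure1 (@lebesgue_measure R) mu) tuple_cons.

Let lebesgue_cons0 : lebesgue_cons set0 = 0%E.
Proof. by rewrite /lebesgue_cons /pushforward preimage_set0 measure0. Qed.

Let lebesgue_cons_ge0 A : (0 <= lebesgue_cons A)%E.
Proof. by rewrite /lebesgue_cons /pushforward measure_ge0. Qed.

Let lebesgue_cons_sigma_additive : semi_sigma_additive lebesgue_cons.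
Proof.
move=> F mF tF mUF; rewrite /lebesgue_cons /pushforward preimage_bigcup.
have mp B : measurable B -> measurable (tuple_cons @^-1` B).
  by move=> mB; rewrite -[X in measurable X]setTI; exact: measurable_tuple_cons.
apply: measure_semi_sigma_additive => [k||]; first exact: mp.
- apply/trivIsetP => /= i j _ _ ij; rewrite -preimage_setI.
  by move/trivIsetP : tF => /(_ _ _ _ _ ij) ->//; rewrite preimage_set0.
- by rewrite -preimage_bigcup; exact: mp.
Qed.

HB.instance Definition _ := isMeasure.Build _ _ _ lebesgue_cons
  lebesgue_cons0 lebesgue_cons_ge0 lebesgue_cons_sigma_additive.

Let lebesgue_cons_sigma_finite : sigma_finite setT lebesgue_cons.
Proof.
have /sigma_finiteP[F [TF ndF Foo]] := sigma_finiteT (@lebesgue_measure R).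
have /sigma_finiteP[G [TG ndG Goo]] := sigma_finiteT mu.
pose h (t : n.+1.-tuple R) : R * n.-tuple R :=
  (tnth t ord0, [tuple of behead t]).
have hK : cancel tuple_cons h.
  by move=> [x t]; rewrite /h; congr (_, _); apply/val_inj.
have mh : measurable_fun setT h.
  apply/measurable_fun_pairP; split; first exact: measurable_tnth.
  exact: measurable_behead.
exists (fun k => h @^-1` (F k `*` G k)) => [|k].
  rewrite -preimage_bigcup (_ : \bigcup_k _ = setT) ?preimage_setT//.
  apply/seteqP; split=> // -[x t] _.
  have [a _ Fx] : (\bigcup_k F k) x by rewrite -TF.
  have [b _ Gt] : (\bigcup_k G k) t by rewrite -TG.
  exists (maxn a b) => //; split.
  - by move: x Fx; exact/subsetPset/ndF/leq_maxl.
  - by move: t Gt; exact/subsetPset/ndG/leq_maxr.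
have [[mF Fk] [mG Gk]] := (Foo k, Goo k); split.
  by rewrite -[X in measurable X]setTI; apply: mh => //; exact: measurableX.
rewrite /lebesgue_cons /pushforward -comp_preimage.
rewrite (_ : h \o tuple_cons = id) ?preimage_id; last exact/funext.
by rewrite product_measure1E// lte_mul_pinfty// ge0_fin_numE.
Qed.

HB.instance Definition _ := @Measure_isSigmaFinite.Build _ _ _ lebesgue_cons
  lebesgue_cons_sigma_finite.

End lebesgue_measure_cons.

(* Lebesgue measure on R^n: since R^0 is a point and R^(n+1) = R x R^n, it is
   the point mass for n = 0 and the product of Lebesgue measures otherwise. *)
Fixpoint lebesgue_tuple (R : realType) (n : nat) :
    {sigma_finite_measure set (n.-tuple R) -> \bar R} :=
  match n with
  | 0 => \d_([tuple] : 0.-tuple R)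
  | n'.+1 => lebesgue_cons (lebesgue_tuple R n')
  end.

Definition set_coord (R : realType) (n : nat) (t : n.-tuple R) (i : 'I_n)
    (x : R) : n.-tuple R :=
  [tuple if j == i then x else tnth t j | j < n].

(* The coordinates of t with index in A, in increasing order: if the elements
   of A are i_1 < ... < i_c, then subtuple A t is (t_(i_1), ..., t_(i_c)). *)
Definition subtuple (R : realType) (n : nat) (A : {set 'I_n})
    (t : n.-tuple R) : #|A|.-tuple R :=
  [tuple tnth t (enum_val k) | k < #|A|].

Definition box0 (R : realType) (n : nat) (u : n.-tuple R) :
    set (n.-tuple R) :=
  [set t | forall i, 0 <= tnth t i <= tnth u i].

Definition unit_cube (R : realType) (n : nat) : set (n.-tuple R) :=
  [set t | forall i, 0 <= tnth t i <= 1].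

Definition open_unit_cube (R : realType) (n : nat) : set (n.-tuple R) :=
  [set t | forall i, 0 < tnth t i < 1].

Arguments unit_cube : clear implicits.
Arguments open_unit_cube : clear implicits.

Fixpoint partials (R : realType) (n : nat) (s : seq 'I_n)
    (F : n.-tuple R -> R) : n.-tuple R -> R :=
  if s is i :: s' then
    fun u => derive1 (fun x => partials s' F (set_coord u i x)) (tnth u i)
  else F.

(* [derive1] is total, so the existence of the iterated derivative computed by
   [partials] has to be required separately; the inner derivatives are needed
   only near u_i along the i-th axis. *)
Fixpoint has_partials (R : realType) (n : nat) (s : seq 'I_n)
    (F : n.-tuple R -> R) (u : n.-tuple R) : Prop :=
  if s is i :: s' then
    (\forall x \near tnth u i, has_partials s' F (set_coord u i x)) /\
    derivable (fun x => partials s' F (set_coord u i x)) (tnth u i) 1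
  else True.

(* d^n F / du_1 ... du_n: the derivative in u_n is the innermost one. *)
Definition mixed_partial (R : realType) (n : nat) (F : n.-tuple R -> R) :
    n.-tuple R -> R :=
  partials (enum 'I_n) F.

Definition has_mixed_partial (R : realType) (n : nat) (F : n.-tuple R -> R)
    (u : n.-tuple R) : Prop :=
  has_partials (enum 'I_n) F u.

Section random_vectors.
Context d (T : measurableType d) (R : realType) (P : probability T R).
Context (n : nat).
Implicit Type X : 'I_n -> {RV P >-> R}.

Definition joint X (w : T) : n.-tuple R := [tuple X i w | i < n].

Definition uniform01 (X : {RV P >-> R}) : Prop :=
  forall B : set R, measurable B ->
    distribution P X B = uniform_prob (@ltr01 R) B.

Definition mutually_independent X : Prop :=
  forall (J : {set 'I_n}) (B : 'I_n -> set R),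
    (forall i, measurable (B i)) ->
    P [set w | forall i, i \in J -> B i (X i w)] =
    (\prod_(i in J) P (X i @^-1` B i))%E.

(* C is the restriction of the joint cdf of X to the unit cube; the values of
   C outside the cube are irrelevant. *)
Definition joint_cdf_on_cube X (C : n.-tuple R -> R) : Prop :=
  forall u, unit_cube R n u ->
    (C u)%:E = P [set w | forall i, X i w <= tnth u i].

Definition copula_vector X (C : n.-tuple R -> R) : Prop :=
  (forall i, uniform01 (X i)) /\ joint_cdf_on_cube X C.

Definition joint_density X (f : n.-tuple R -> R) : Prop :=
  [/\ measurable_fun setT f, (forall t, 0 <= f t) &
      forall B, measurable B ->
        P (joint X @^-1` B) = (\int[lebesgue_tuple R n]_(t in B) (f t)%:E)%E].

(* Y is a version of the conditional expectation E(X | G), where G is a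
   sigma-algebra contained in that of T. *)
Definition cond_expectation (G : set (set T)) (X : T -> R)
    (Y : T -> \bar R) : Prop :=
  [/\ P.-integrable setT (EFin \o X),
      P.-integrable setT Y,
      (forall B, measurable B -> G (Y @^-1` B)) &
      forall A, G A -> (\int[P]_(w in A) Y w = \int[P]_(w in A) (X w)%:E)%E].

End random_vectors.

Definition copula (R : realType) (n : nat) (C : n.-tuple R -> R) : Prop :=
  exists (d : measure_display) (T : measurableType d) (P : probability T R)
         (X : 'I_n -> {RV P >-> R}),
    copula_vector X C.

(* The density is only determined up to a null set, and it agrees with the
   mixed partial derivative of C almost everywhere. *)
Definition absolutely_continuous_copula (R : realType) (n : nat)
    (C : n.-tuple R -> R) : Prop :=
  exists (d : measure_display) (T : measurableType d) (P : probability T R)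
         (X : 'I_n -> {RV P >-> R}) (f : n.-tuple R -> R),
    [/\ copula_vector X C,
        joint_density X f &
        {ae lebesgue_tuple R n, forall u, open_unit_cube R n u ->
          has_mixed_partial C u /\ f u = mixed_partial C u}].

(* The index sequences 1 <= i_1 < ... < i_c <= n with c >= 2 are the subsets
   of 'I_n with at least two elements. *)
Definition U_tilde (R : realType) (n : nat)
    (g : forall A : {set 'I_n}, #|A|.-tuple R -> R) (t : n.-tuple R) : R :=
  \sum_(A : {set 'I_n} | (2 <= #|A|)%N) g A (subtuple A t).

(* Main.v *)
(** Write Q for the uniform law on the cube.

    Necessity is the Hoeffding decomposition of the density f: with f_B the
    marginal of f on the coordinates in B, the functions
    g_A = sum_(B \subset A) (-1)^|A \ B| f_B sum to f, integrate to 0 in each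
    coordinate of A, and g_A = 1 for A empty, g_A = 0 for singletons A, since
    the one-dimensional marginals are uniform.

    Sufficiency: by (A5) and Fubini each g_A integrates to 0 over every set
    that constrains a single coordinate, so 1 + U is a probability density with
    uniform marginals. The remaining point is that the primitive
    F(u) = \int_(t <= u) f has the iterated derivative
    d/du_1 (... (d/du_n F)) = f almost everywhere, where the inner derivatives
    must exist for all nearby values of the outer variables. Integrating out
    the outer variables s against a weight w, one has to differentiate
    y |-> \int w(s) (\int_0^y f(s, x) dx) ds outside a null set of y that does
    not depend on w. At almost every y the difference quotients converge to
    f(s, y) for almost every s, and their integrals over s converge; as they
    are nonnegative, Scheffe's lemma gives convergence in L^1, hence for all
    weights simultaneously. *)
Require Import Defs.
From HB Require Import structures.
From mathcomp Require Import all_boot all_order all_algebra.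
From mathcomp Require Import all_classical all_reals all_analysis.
From mathcomp Require Import measurable_realfun.
From mathcomp Require Import ring lra.

Import Order.TTheory GRing.Theory Num.Theory.
Import numFieldNormedType.Exports.

Local Open Scope classical_set_scope.
Local Open Scope ring_scope.

Set Implicit Arguments.
Unset Strict Implicit.
Unset Printing Implicit Defensive.

(** * The uniform law on the cube *)

(** The vector V lives on an arbitrary probability space, so its conditions are moved to its law Q
    on tuples, which is known through boxes only. Q is invariant under replacing one coordinate, or
    all coordinates outside a set A, by independent copies. This invariance plays the role of Fubini
    in a chosen coordinate and lets marginals and centered terms be functions of the full tuple.
    Almost sure statements pass from Q to V freely, but back only for measurable events. In the
    differentiation argument, exchanging null sets between variables requires the set of pairs (s,
    x) such that x is not a Lebesgue point of the section at s to be measurable; for this the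
    averages are taken along the radii 1/(k+1). The weight must be quantified after the point u: the
    outer derivative looks at all x near u_1, and each x changes the weight. A conditional
    expectation must be measurable exactly, not up to a null set, for the sigma-algebra of the
    coordinates other than i_k. That sigma-algebra is described as the one generated by the map that
    freezes coordinate i_k at 0. *)

Definition box {R : realType} {n : nat} (B : 'I_n -> set R) :
  set (n.-tuple R) := [set t | forall i, B i (tnth t i)].

Section uniform01_prob.
Variable R : realType.
Local Notation unif := (uniform_prob (@ltr01 R)).

(* [lebesgue_measure] and [uniform_prob] are measures on [measurableTypeR R],
   whose measure display differs from that of [R], on which random variables
   and tuples live; the sigma-algebras are convertible. *)
Definition uniform01_prob : set R -> \bar R := unif.

Let uniform01_prob0 : uniform01_prob set0 = 0%E.
Proof. exact: (measure0 unif). Qed.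

Let uniform01_prob_ge0 A : (0 <= uniform01_prob A)%E.
Proof. exact: (measure_ge0 unif). Qed.

Let uniform01_prob_additive : semi_sigma_additive uniform01_prob.
Proof. exact: (@measure_semi_sigma_additive _ _ _ unif). Qed.

HB.instance Definition _ := isMeasure.Build _ _ _ uniform01_prob
  uniform01_prob0 uniform01_prob_ge0 uniform01_prob_additive.

Let uniform01_probT : uniform01_prob setT = 1%E.
Proof. exact: (@probability_setT _ _ _ unif). Qed.

HB.instance Definition _ := @Measure_isProbability.Build _ _ R
  uniform01_prob uniform01_probT.

End uniform01_prob.
Section boxes.
Context {R : realType}.
Local Notation leb := (@lebesgue_measure R).
Local Notation unif := (@uniform01_prob R).

Lemma boxE n (B : 'I_n -> set R) :
  box B = \bigcap_(i in [set: 'I_n]) ((fun t => tnth t i) @^-1` B i).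
Proof.
by apply/seteqP; split=> t /= Bt i => [_|]; [exact: Bt|exact: (Bt i I)].
Qed.

Lemma measurable_box n (B : 'I_n -> set R) :
  (forall i, measurable (B i)) -> measurable (box B).
Proof.
move=> mB; rewrite boxE; apply: fin_bigcap_measurable => // i _.
rewrite -[X in measurable X]setTI.
exact: (@measurable_tnth _ _ n i).
Qed.

(** Boxes form a pi-system that generates the product sigma-algebra, since a cylinder over one
    coordinate is a box with all other sides equal to R. The whole space is itself a box, so
    finiteness of [m1] there suffices for uniqueness. *)
Lemma measure_box_unique n (m1 m2 : {measure set (n.-tuple R) -> \bar R}) :
  (m1 setT < +oo)%E ->
  (forall B : 'I_n -> set R, (forall i, measurable (B i)) ->
    m1 (box B) = m2 (box B)) ->
  forall A, measurable A -> m1 A = m2 A.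
Proof.
move=> m1oo m12 A mA.
pose G := [set C : set (n.-tuple R) |
  exists2 B : 'I_n -> set R, (forall i, measurable (B i)) & C = box B].
have boxT : box (fun _ : 'I_n => @setT R) = setT by apply/seteqP; split.
apply: (measure_unique G (fun=> setT)) => //.
- apply/seteqP; split; last first.
    apply: smallest_sub; first exact: sigma_algebra_measurable.
    by move=> _ [B mB ->]; exact: measurable_box.
  apply: sub_smallest2r; first exact: smallest_sigma_algebra.
  move=> C.
  rewrite -bigcup_seq/= => -[i _ [B mB <-]]; rewrite setTI.
  exists (fun j => if j == i then B else setT).
    by move=> j; case: ifP.
  apply/seteqP; split=> t /=; first by move=> Bt j; case: eqP => // ->.
  by move=> /(_ i); rewrite eqxx.
- move=> _ _ [B mB ->] [B' mB' ->]; exists (fun i => B i `&` B' i).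
    by move=> i; exact: measurableI.
  apply/seteqP; split=> t /=.
    by move=> [Bt Bt'] i; split; [exact: Bt|exact: Bt'].
  by move=> BB; split=> i; have [] := BB i.
- by move=> _; exists (fun=> setT).
- by rewrite bigcup_const//; exists 0.
- by move=> _ [B mB ->]; exact: m12.
Qed.

Lemma uniform_prob01E (B : set R) : measurable B ->
  unif B = leb (B `&` `[0, 1]).
Proof.
move=> mB; rewrite /uniform01_prob/= /uniform_prob integral_uniform_pdf.
rewrite (eq_integral (fun=> 1%E)).
  by rewrite integral_cst ?mul1e//; exact: measurableI.
move=> x; rewrite inE/= in_itv/= => -[_ x01].
by rewrite /uniform_pdf x01 subr0 invr1.
Qed.

Lemma integral_uniform_prob01 (f : R -> \bar R) : measurable_fun setT f ->
  (\int[unif]_x f x = \int[leb]_(x in `[0%R, 1%R]) f x)%E.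
Proof.
have mid : measurable_fun [set: measurableTypeR R] (id : measurableTypeR R -> R).
  by [].
have ge0 (g : R -> \bar R) : measurable_fun setT g -> (forall x, 0 <= g x)%E ->
    (\int[unif]_x g x = \int[leb]_(x in `[0%R, 1%R]) g x)%E.
  move=> mg g0.
  transitivity (\int[uniform_prob (@ltr01 R)]_x g x)%E.
    (* The pushforward along the identity carries the integral from one measure display to the
       other. *)
    have := @ge0_integral_pushforward _ _ _ _ _ _ mid (uniform_prob (@ltr01 R))
      setT g measurableT mg.
    by rewrite preimage_setT => <-.
  by rewrite integral_uniform// subr0 invr1 mul1e.
move=> mf; rewrite [LHS]integralE [RHS]integralE !ge0//.
- exact: measurable_funeneg.
- exact: measurable_funepos.
Qed.

Lemma lebesgue_tuple_box n (B : 'I_n -> set R) : (forall i, measurable (B i)) ->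
  lebesgue_tuple R n (box B) = (\prod_(i < n) leb (B i))%E.
Proof.
elim: n B => [|n IH] B mB.
  by rewrite big_ord0 /= diracE mem_set//= => -[].
rewrite /= /lebesgue_cons /pushforward.
rewrite (_ : _ @^-1` _ = B ord0 `*` box (fun i => B (lift ord0 i))).
  rewrite product_measure1E; [|exact: mB|exact: measurable_box].
  by rewrite big_ord_recl IH.
rewrite eqEsubset; split=> -[x t] /=.
  move=> Bt; split; first exact: (Bt ord0).
  by move=> i; have := Bt (lift ord0 i); rewrite /tuple_cons/= tnthS.
move=> [Bx Bt] i; case: (unliftP ord0 i) => [j ->|->]//=.
by rewrite /tuple_cons/= tnthS; exact: Bt.
Qed.

Lemma unit_cubeE n : unit_cube R n = box (fun=> `[0, 1]%classic).
Proof. by apply/seteqP; split=> t /= h i; have := h i; rewrite /= in_itv/=. Qed.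

Lemma measurable_unit_cube n : measurable (unit_cube R n).
Proof. by rewrite unit_cubeE; apply: measurable_box => i; exact: measurable_itv. Qed.

(** All that is retained of the independence and uniformity of V_1, ..., V_n. *)
Definition uniform_on_cube {n} (Q : {measure set (n.-tuple R) -> \bar R}) :=
  forall B : 'I_n -> set R, (forall i, measurable (B i)) ->
    Q (box B) = (\prod_(i < n) unif (B i))%E.

Lemma uniform_on_cubeE n (Q : probability (n.-tuple R) R) :
  uniform_on_cube Q -> forall A, measurable A ->
  Q A = lebesgue_tuple R n (A `&` unit_cube R n).
Proof.
move=> hQ A mA.
pose m := mrestr (lebesgue_tuple R n) (@measurable_unit_cube n).
rewrite (_ : lebesgue_tuple R n _ = m A)//.
apply: measure_box_unique => //.
  exact: le_lt_trans (probability_le1 Q measurableT) (ltry _).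
move=> B mB; rewrite hQ// /m/= /mrestr unit_cubeE.
rewrite (_ : box B `&` _ = box (fun i => B i `&` `[0, 1]%classic)).
  rewrite lebesgue_tuple_box.
    by apply: eq_bigr => i _; rewrite uniform_prob01E.
  by move=> i; exact: measurableI.
apply/seteqP; split=> t /=.
  by move=> [Bt Bt'] i; split; [exact: Bt|exact: Bt'].
by move=> BB; split=> i; have [] := BB i.
Qed.

Lemma integral_uniform_on_cube n (Q : probability (n.-tuple R) R) :
  uniform_on_cube Q -> forall (D : set (n.-tuple R)) (f : n.-tuple R -> \bar R),
  measurable D -> measurable_fun setT f ->
  (\int[Q]_(t in D) f t = \int[lebesgue_tuple R n]_(t in D `&` unit_cube R n) f t)%E.
Proof.
move=> hQ D f mD mf; have mC := @measurable_unit_cube n.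
transitivity (\int[Q]_(t in D `&` unit_cube R n) f t)%E; last first.
  apply: eq_measure_integral => A mA AC.
  apply: etrans (uniform_on_cubeE hQ mA) _.
  by rewrite setIidl// => x /AC[].
rewrite integral_mkcondr.
apply: ae_eq_integral => //; first exact: measurable_funTS.
  apply: (measurable_restrict f mC mD).1.
  exact: (measurable_funS measurableT (@subsetT _ _) mf).
exists (~` unit_cube R n); split; first exact: measurableC.
  by apply: etrans (uniform_on_cubeE hQ (measurableC mC)) _; rewrite setICl.
move=> t /= /not_implyP[Dt]; rewrite patchE; case: ifPn => //.
by rewrite notin_setE.
Qed.

End boxes.

(** * Transport of integrals and null sets along a law *)

Section law.
Context d (S : measurableType d) {R : realType} (n : nat).
Variables (m : {measure set S -> \bar R}) (f : S -> n.-tuple R).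
Variable Q : {measure set (n.-tuple R) -> \bar R}.
Hypothesis mf : measurable_fun setT f.

Definition has_law := forall B, measurable B -> m (f @^-1` B) = Q B.

Lemma has_law_box : (Q setT < +oo)%E ->
  (forall B : 'I_n -> set R, (forall i, measurable (B i)) ->
    m (f @^-1` box B) = Q (box B)) -> has_law.
Proof.
move=> Qoo mQ B mB; rewrite -[LHS]/(pushforward m f B); apply: esym.
move: B mB; apply: measure_box_unique; try exact: mf.
  exact: Qoo.
by move=> B mB; rewrite -mQ.
Qed.

Hypothesis fQ : has_law.

Lemma ge0_integral_law (h : n.-tuple R -> \bar R) : measurable_fun setT h ->
  (forall t, 0 <= h t)%E -> (\int[Q]_t h t = \int[m]_s h (f s))%E.
Proof.
move=> mh h0.
have := @ge0_integral_pushforward _ _ _ _ _ _ mf m setT h measurableT mh.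
rewrite preimage_setT => <-//.
apply: eq_measure_integral; try exact: mf.
by move=> B mB _; rewrite -fQ.
Qed.

Lemma integrable_law (h : n.-tuple R -> \bar R) : measurable_fun setT h ->
  Q.-integrable setT h <-> m.-integrable setT (h \o f).
Proof.
move=> mh; have mah : measurable_fun setT (fun t => `|h t|%E).
  exact: (measurableT_comp (@abse_measurable _ _) mh).
split=> /integrableP[_ h_oo]; apply/integrableP; split=> //.
- exact: measurableT_comp.
- by rewrite -(ge0_integral_law mah).
- by rewrite (ge0_integral_law mah).
Qed.

Lemma integral_law (h : n.-tuple R -> \bar R) : Q.-integrable setT h ->
  (\int[Q]_t h t = \int[m]_s h (f s))%E.
Proof.
move=> ih; have mh := measurable_int _ ih.
rewrite [LHS]integralE [RHS]integralE !ge0_integral_law//.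
- by congr (_ - _)%E; apply: eq_integral => s _; rewrite ?funeposE ?funenegE.
- exact: measurable_funeneg.
- exact: measurable_funepos.
Qed.

Lemma ae_law (p : n.-tuple R -> Prop) :
  {ae Q, forall t, p t} -> {ae m, forall s, p (f s)}.
Proof.
move=> [N [mN N0 pN]]; exists (f @^-1` N); split.
- by rewrite -[X in measurable X]setTI; exact: mf.
- by rewrite fQ.
- by move=> s /= ps; apply: pN.
Qed.

(** A null set covering the preimage of the bad set says nothing about its image in the tuples; only
    when the bad set is measurable is its Q-measure that of its preimage. *)
Lemma ae_law_inv (p : n.-tuple R -> Prop) : measurable [set t | p t] ->
  {ae m, forall s, p (f s)} -> {ae Q, forall t, p t}.
Proof.
move=> mp pf; have mnp := measurableC mp.
apply/negligibleP => //; apply: etrans (esym (fQ mnp)) _.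
apply/negligibleP => //.
by rewrite -[X in measurable X]setTI; exact: mf.
Qed.

End law.

(** * Replacing coordinates by independent copies *)

Section resampling.
Context {R : realType} {n : nat} (Q : probability (n.-tuple R) R).
Hypothesis hQ : uniform_on_cube Q.
Local Notation leb := (@lebesgue_measure R).
Local Notation unif := (@uniform01_prob R).
Implicit Types (t v : n.-tuple R) (A : {set 'I_n}) (k : 'I_n).

Lemma tnth_set_coord t k x i :
  tnth (set_coord t k x) i = if i == k then x else tnth t i.
Proof. by rewrite tnth_mktuple. Qed.

Lemma measurable_set_coord k :
  measurable_fun [set: R * n.-tuple R] (fun p => set_coord p.2 k p.1).
Proof.
apply/measurable_fun_tnthP => i /=.
rewrite (_ : _ \o _ = fun p : R * n.-tuple R =>
    if i == k then p.1 else tnth p.2 i).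
  case: (i == k); first exact: measurable_fst.
  exact: (measurableT_comp (measurable_tnth i) measurable_snd).
by apply/funext => p /=; rewrite tnth_set_coord.
Qed.

Definition merge A t v : n.-tuple R :=
  [tuple if i \in A then tnth t i else tnth v i | i < n].

Lemma measurable_merge A :
  measurable_fun [set: n.-tuple R * n.-tuple R] (fun p => merge A p.1 p.2).
Proof.
apply/measurable_fun_tnthP => i /=.
rewrite (_ : _ \o _ = fun p : n.-tuple R * n.-tuple R =>
    if i \in A then tnth p.1 i else tnth p.2 i).
  case: (i \in A).
    exact: (measurableT_comp (measurable_tnth i) measurable_fst).
  exact: (measurableT_comp (measurable_tnth i) measurable_snd).
by apply/funext => p /=; rewrite tnth_mktuple.
Qed.

(** In the preimage of a box the condition on coordinate k falls on the fresh variable and all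
    others on t, so it is a product set whose second factor leaves coordinate k free. This gives
    Fubini in coordinate k without cutting tuples at k. *)
Lemma set_coord_law k :
  has_law (product_measure1 unif Q) (fun p => set_coord p.2 k p.1) Q.
Proof.
apply: has_law_box; first exact: measurable_set_coord.
  exact: le_lt_trans (probability_le1 Q measurableT) (ltry _).
move=> B mB; rewrite hQ//.
rewrite (_ : _ @^-1` _ = B k `*` box (fun i => if i == k then setT else B i)).
  apply: etrans (product_measure1E _ _ (mB k) _) _.
    by apply: measurable_box => i; case: ifP.
    rewrite hQ; last by move=> i; case: ifP.
    rewrite (bigD1 k)//= [in RHS](bigD1 k)//= eqxx probability_setT mul1e.
    by congr (_ * _)%E; apply: eq_bigr => i /negbTE ->.
rewrite eqEsubset; split=> -[x t] /=.
  move=> Bt; split; first by have := Bt k; rewrite tnth_set_coord eqxx.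
  by move=> i; have := Bt i; rewrite tnth_set_coord; case: eqP.
move=> [Bx Bt] i; rewrite tnth_set_coord; case: eqP => [->//|/eqP ik].
by have := Bt i; rewrite (negbTE ik).
Qed.

(** Each side of a box constrains exactly one of the two independent tuples. Integrating out the
    second one is then the passage to the marginal on A. *)
Lemma merge_law A :
  has_law (product_measure1 Q Q) (fun p => merge A p.1 p.2) Q.
Proof.
apply: has_law_box; first exact: measurable_merge.
  exact: le_lt_trans (probability_le1 Q measurableT) (ltry _).
move=> B mB; rewrite hQ//.
rewrite (_ : _ @^-1` _ = box (fun i => if i \in A then B i else setT) `*`
    box (fun i => if i \in A then setT else B i)).
  apply: etrans (product_measure1E _ _ _ _) _.
  - by apply: measurable_box => i; case: ifP.
  - by apply: measurable_box => i; case: ifP.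
  rewrite !hQ; try by move=> i; case: ifP.
  rewrite -big_split/=; apply: eq_bigr => i _.
  by case: ifP; rewrite probability_setT ?mule1 ?mul1e.
rewrite eqEsubset; split=> -[t v] /=.
  by move=> Bt; split=> i; have := Bt i; rewrite tnth_mktuple; case: ifP.
move=> [Bt Bv] i; rewrite tnth_mktuple.
by have := Bt i; have := Bv i; case: ifP.
Qed.

Lemma ge0_integral_resample k (h : n.-tuple R -> \bar R) :
  measurable_fun setT h -> (forall t, 0 <= h t)%E ->
  (\int[Q]_t h t = \int[Q]_t \int[leb]_(x in `[0%R, 1%R]) h (set_coord t k x))%E.
Proof.
move=> mh h0; have mhk := measurableT_comp mh (measurable_set_coord k).
rewrite (ge0_integral_law (measurable_set_coord k) (set_coord_law k))//.
rewrite (fubini_tonelli2 (fun p => h (set_coord p.2 k p.1)))//.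
apply: eq_integral => t _; rewrite -integral_uniform_prob01//.
exact: (measurableT_comp mhk (pair2_measurable t)).
Qed.

Lemma ge0_integral_merge A (h : n.-tuple R -> \bar R) :
  measurable_fun setT h -> (forall t, 0 <= h t)%E ->
  (\int[Q]_t h t = \int[Q]_t \int[Q]_v h (merge A t v))%E.
Proof.
move=> mh h0; have mhA := measurableT_comp mh (measurable_merge A).
rewrite (ge0_integral_law (measurable_merge A) (merge_law A))//.
by rewrite (fubini_tonelli1 (fun p => h (merge A p.1 p.2))).
Qed.

Lemma integral_resample k (h : n.-tuple R -> \bar R) :
  Q.-integrable setT h ->
  (\int[Q]_t h t = \int[Q]_t \int[leb]_(x in `[0%R, 1%R]) h (set_coord t k x))%E.
Proof.
move=> ih; have mh := measurable_int _ ih.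
have mhk := measurableT_comp mh (measurable_set_coord k).
rewrite (integral_law (measurable_set_coord k) (set_coord_law k))//.
have /(integrable_law (measurable_set_coord k) (set_coord_law k) mh) ihk := ih.
rewrite -(integral21_prod_meas1 ihk).
apply: eq_integral => t _; rewrite -integral_uniform_prob01//.
exact: (measurableT_comp mhk (pair2_measurable t)).
Qed.

Lemma measurable_subtuple A : measurable_fun setT (@subtuple R n A).
Proof.
apply/measurable_fun_tnthP => i /=.
rewrite (_ : _ \o _ = fun t : n.-tuple R => tnth t (enum_val i)).
  exact: measurable_tnth.
by apply/funext => t /=; rewrite tnth_mktuple.
Qed.

Lemma uniform_on_cube_subtuple A (Q' : probability (#|A|.-tuple R) R) :
  has_law Q (subtuple A) Q' -> uniform_on_cube Q'.
Proof.
move=> Q'E B mB; apply: etrans (esym (Q'E _ (measurable_box mB))) _.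
(* [B' i] is [B j] if i is the j-th element of A, and all of R if i is outside A, the intersection
   being empty. *)
pose B' (i : 'I_n) := \bigcap_(j in [set j : 'I_#|A| | enum_val j = i]) B j.
have mB' i : measurable (B' i).
  by apply: fin_bigcap_measurable => // j _; exact: mB.
rewrite (_ : _ @^-1` _ = box B').
  rewrite hQ// (bigID (mem A))/= [X in (_ * X)%E]big1 ?mule1 => [|i iA].
    rewrite big_enum_val/=; apply: eq_bigr => j _; congr (unif _).
    apply/seteqP; split=> x /=; first by move=> /(_ j); exact.
    by move=> Bx j' /enum_val_inj ->.
  rewrite (_ : B' i = setT) ?probability_setT//.
  apply/seteqP; split=> x //= _ j ji; exfalso.
  by move: iA; rewrite -ji enum_valP.
apply/seteqP; split=> t /=.
  by move=> Bt i j /= <-; have := Bt j; rewrite tnth_mktuple.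
by move=> Bt j; rewrite tnth_mktuple; apply: Bt.
Qed.

End resampling.

Section joint_law.
Context d (T : measurableType d) (R : realType) (P : probability T R) (n : nat).
Variable V : 'I_n -> {RV P >-> R}.

Lemma measurable_joint : measurable_fun setT (joint V).
Proof.
apply/measurable_fun_tnthP => i /=.
rewrite (_ : _ \o _ = V i); first exact: measurable_funP.
by apply/funext => w /=; rewrite tnth_mktuple.
Qed.

Lemma uniform_on_cube_joint (Q : probability (n.-tuple R) R) :
  (forall i, uniform01 (V i)) -> mutually_independent V ->
  has_law P (joint V) Q -> uniform_on_cube Q.
Proof.
move=> Vunif Vind QE B mB; apply: etrans (esym (QE _ (measurable_box mB))) _.
have := Vind [set: 'I_n]%SET B mB.
have -> : [set w | forall i, i \in [set: 'I_n]%SET -> B i (V i w)] =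
    joint V @^-1` box B.
  apply/seteqP; split=> w /= Bw i.
    by rewrite tnth_mktuple; apply: Bw; rewrite inE.
  by have := Bw i; rewrite tnth_mktuple.
move=> h; apply: etrans h _; apply: eq_big => [i|i _]; first by rewrite inE.
exact: Vunif.
Qed.

End joint_law.

(** * Differentiation of primitives on R^n *)

Section scheffe.
Context d (S : measurableType d) (R : realType).
Variable nu : {measure set S -> \bar R}.

(** Only min(q_n, g) is dominated, by g itself, so dominated convergence applies to it; then |q_n -
    g| = q_n + g - 2 min(q_n, g) and the assumed convergence of the integrals of q_n conclude. *)
Lemma scheffe (q : nat -> S -> R) (g : S -> R) :
  (forall n, nu.-integrable setT (EFin \o q n)) ->
  nu.-integrable setT (EFin \o g) ->
  {ae nu, forall s, forall n, 0 <= q n s} -> (forall s, 0 <= g s) ->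
  {ae nu, forall s, q n s @[n --> \oo] --> g s} ->
  \int[nu]_s q n s @[n --> \oo] --> \int[nu]_s g s ->
  \int[nu]_s `|q n s - g s| @[n --> \oo] --> 0.
Proof.
move=> iq ig q0 g0 qg Iqg.
have mq n : measurable_fun setT (q n) by apply/measurable_EFinP; case/integrableP: (iq n).
have mg : measurable_fun setT g by apply/measurable_EFinP; case/integrableP: ig.
pose m n s := Num.min (q n s) (g s).
have mm n : measurable_fun setT (m n) by exact: measurable_minr.
have m_le : {ae nu, forall s, forall n, `|m n s| <= g s}.
  apply: filterS q0 => s q0 n; rewrite ger0_norm ?ge_min ?lexx ?orbT//.
  by rewrite le_min q0 g0.
have im n : nu.-integrable setT (EFin \o m n).
  apply/integrableP; split; first exact/measurable_EFinP.
  case/integrableP: (ig) => _; apply: le_lt_trans.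
  apply: ae_ge0_le_integral => //.
  - by apply: measurableT_comp => //; exact/measurable_EFinP.
  - by apply: measurableT_comp => //; exact/measurable_EFinP.
  apply: filterS m_le => s /(_ n) mns _ /=.
  by rewrite lee_fin (ger0_norm (g0 s)).
have Im : \int[nu]_s m n s @[n --> \oo] --> \int[nu]_s g s.
  have [|||||_ _ h] := @dominated_convergence _ _ _ nu setT measurableT
    (fun n => EFin \o m n) (EFin \o g) (EFin \o g).
  - by move=> n; exact/measurable_EFinP.
  - exact/measurable_EFinP.
  - apply: filterS qg => s qgs _ /=; apply/cvg_EFin; first exact: nearW.
    apply/cvgrPdist_lt => e e0; move/cvgrPdist_lt : qgs => /(_ e e0).
    apply: filterS => n; apply: le_lt_trans; rewrite /m /=.
    by rewrite /Order.min; case: ifP => _; rewrite ?lexx// subrr normr0.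
  - exact: ig.
  - by apply: filterS m_le => s ms n _ /=; rewrite lee_fin.
  by apply: fine_cvg; move: h; rewrite /= fineK// integrable_fin_num.
have -> : (fun n => \int[nu]_s `|q n s - g s|) =
    (fun n => \int[nu]_s q n s + \int[nu]_s g s - 2 * \int[nu]_s m n s).
  apply/funext => n; have i2m : nu.-integrable setT (EFin \o (fun s => 2 * m n s)).
    exact: (integrableZl measurableT 2 (im n)).
  rewrite -RintegralZl// -RintegralD// -RintegralB//; last first.
    exact: (integrableD measurableT (iq n) ig).
  apply: eq_Rintegral => s _; rewrite /m.
  have [qgs|qgs] := leP (q n s) (g s).
    by rewrite ler0_norm ?subr_le0// mulr_natl mulr2n; ring.
  by rewrite gtr0_norm ?subr_gt0// mulr_natl mulr2n; ring.
have -> : 0 = \int[nu]_s g s + \int[nu]_s g s - 2 * \int[nu]_s g s by ring.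
by apply: cvgB; [apply: cvgD => //; exact: cvg_cst|apply: cvgMr].
Qed.

Lemma scheffe_weighted (q : nat -> S -> R) (g w : S -> R) :
  (forall n, nu.-integrable setT (EFin \o q n)) ->
  nu.-integrable setT (EFin \o g) ->
  {ae nu, forall s, forall n, 0 <= q n s} -> (forall s, 0 <= g s) ->
  {ae nu, forall s, q n s @[n --> \oo] --> g s} ->
  \int[nu]_s q n s @[n --> \oo] --> \int[nu]_s g s ->
  measurable_fun setT w -> (forall s, 0 <= w s <= 1) ->
  \int[nu]_s (w s * q n s) @[n --> \oo] --> \int[nu]_s (w s * g s).
Proof.
move=> iq ig q0 g0 qg Iqg mw w01.
have iw (f : S -> R) : nu.-integrable setT (EFin \o f) ->
    nu.-integrable setT (EFin \o (fun s => w s * f s)).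
  move=> /[dup] if_ /integrableP[/measurable_EFinP mf _].
  apply: le_integrable if_ => //; first exact/measurable_EFinP/measurable_funM.
  move=> s _ /=; rewrite lee_fin normrM ler_piMl//.
  by have /andP[w0 w1] := w01 s; rewrite ger0_norm.
have iqg n : nu.-integrable setT (EFin \o (fun s => q n s - g s)).
  exact: (integrableB measurableT (iq n) ig).
apply/subr_cvg0/norm_cvg0P.
apply: (squeeze_cvgr _ (cvg_cst 0) (scheffe iq ig q0 g0 qg Iqg)).
apply: nearW => n; rewrite normr_ge0/= -RintegralB ?iw//.
apply: (@le_trans _ _ (\int[nu]_s `|w s * (q n s - g s)|)).
  under eq_Rintegral do rewrite -mulrBr.
  by apply: le_normr_Rintegral => //; exact: iw.
apply: le_Rintegral => //.
- exact/integrable_norm/iw.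
- exact/integrable_norm.
move=> s _; rewrite normrM ler_piMl//.
by have /andP[w0 w1] := w01 s; rewrite ger0_norm.
Qed.

(* No domination is available for the difference quotients; Scheffe's lemma
   replaces it, and gives the derivative for all weights at once. *)
Lemma derivative_under_integral_monotone (H : R -> S -> R) (h w : S -> R) (a : R) :
  (forall x, nu.-integrable setT (EFin \o H x)) ->
  nu.-integrable setT (EFin \o h) -> (forall s, 0 <= h s) ->
  {ae nu, forall s, {homo H^~ s : x y / x <= y}} ->
  {ae nu, forall s, r^-1 *: (H (r + a) s - H a s) @[r --> 0^'] --> h s} ->
  r^-1 *: (\int[nu]_s H (r + a) s - \int[nu]_s H a s) @[r --> 0^']
    --> \int[nu]_s h s ->
  measurable_fun setT w -> (forall s, 0 <= w s <= 1) ->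
  r^-1 *: (\int[nu]_s (w s * H (r + a) s) - \int[nu]_s (w s * H a s))
    @[r --> 0^'] --> \int[nu]_s (w s * h s).
Proof.
move=> iH ih h0 Hnd Hh IHh mw w01.
have iw (f : S -> R) : nu.-integrable setT (EFin \o f) ->
    nu.-integrable setT (EFin \o (fun s => w s * f s)).
  move=> /[dup] if_ /integrableP[/measurable_EFinP mf _].
  apply: le_integrable if_ => //; first exact/measurable_EFinP/measurable_funM.
  move=> s _ /=; rewrite lee_fin normrM ler_piMl//.
  by have /andP[w0 w1] := w01 s; rewrite ger0_norm.
(* Dominated convergence works along sequences, so the limit is tested on every nonzero sequence
   tending to 0. *)
apply/cvgr_dnbhsP => r [r_neq0 r0].
pose q n s := (r n)^-1 * (H (r n + a) s - H a s).
have iB n : nu.-integrable setT (EFin \o (fun s => H (r n + a) s - H a s)).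
  exact: (integrableB measurableT (iH _) (iH _)).
have iq n : nu.-integrable setT (EFin \o q n).
  exact: (integrableZl measurableT (r n)^-1 (iB n)).
rewrite [X in X @ \oo --> _](_ : _ = fun n => \int[nu]_s (w s * q n s)); last first.
  apply/funext => n /=; rewrite -RintegralB ?iw// /GRing.scale/= -RintegralZl//.
    by apply: eq_Rintegral => s _; rewrite /q; ring.
  exact: (integrableB measurableT (iw _ (iH _)) (iw _ (iH _))).
apply: scheffe_weighted => //.
- apply: filterS Hnd => s Hs n; rewrite /q.
  have [rn|rn] := leP 0 (r n).
    by rewrite mulr_ge0 ?invr_ge0// subr_ge0 Hs// lerDr.
  by rewrite mulr_le0 ?invr_le0 ?(ltW rn)// subr_le0 Hs// gerDr ltW.
- by apply: filterS Hh => s /cvgr_dnbhsP; apply.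
- rewrite (_ : (fun n => _) = fun n => (r n)^-1 *:
      (\int[nu]_s H (r n + a) s - \int[nu]_s H a s)).
    by move/cvgr_dnbhsP : IHh; apply.
  by apply/funext => n; rewrite /q RintegralZl// RintegralB.
Qed.

End scheffe.

(** * Lebesgue points of the sections of a function of two variables *)

Section lebesgue_points.
Context {R : realType}.
Local Notation leb := (@lebesgue_measure R).
Local Open Scope ereal_scope.

(** The smaller ball lies in the larger one, which is at most twice as long. *)
Let davg_le (f : R -> R) (x r s : R) : measurable_fun setT f ->
  (0 < r)%R -> (r <= s)%R -> (s <= 2 * r)%R -> davg f x r <= 2%:E * davg f x s.
Proof.
move=> mf r0 rs sr; have s0 := lt_le_trans r0 rs.
rewrite /davg /iavg (lebesgue_measure_ball _ (ltW r0)).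
rewrite (lebesgue_measure_ball _ (ltW s0)) !inver !mulrn_eq0/=.
rewrite !gt_eqF// muleA -EFinM.
pose F y := `|((center (f x) \o f) y)%:E|.
set I := integral _ _ _; set J := integral _ _ _.
rewrite -/F in I J *.
have IJ : I <= J.
  apply: ge0_subset_integral => //; try exact: measurable_ball.
    apply: measurableT_comp => //; apply/measurable_EFinP/measurable_funTS.
    by apply: measurable_funB.
  by move=> y; rewrite /ball/=; move=> /lt_le_trans; apply.
have J0 : 0 <= J by apply: integral_ge0.
apply: (@le_trans _ _ ((r *+ 2)^-1%:E * J)).
  by rewrite lee_wpmul2l// lee_fin invr_ge0 mulrn_wge0// ltW.
rewrite lee_wpmul2r// lee_fin.
rewrite (_ : (2 / (s *+ 2) = s^-1)%R).
  by rewrite lef_pV2 ?posrE ?mulrn_wgt0// -mulr_natl.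
by rewrite -(mulr_natl s 2) invfM mulrA divff// mul1r.
Qed.

(** A criterion with countably many radii, from which the set of Lebesgue points of a family of
    functions is seen to be measurable jointly in parameter and point. *)
Lemma lebesgue_ptP (f : R -> R) (x : R) : measurable_fun setT f ->
  lebesgue_pt f x <-> limn_esup (fun k => davg f x k.+1%:R^-1) <= 0.
Proof.
move=> mf; split=> [fx|fx0].
  have cv : davg f x k.+1%:R^-1 @[k --> \oo] --> 0.
    move/cvge_at_rightP : fx; apply; split; first by move=> k; rewrite invr_gt0.
    exact: cvg_harmonic.
  by rewrite is_cvg_limn_esupE; [rewrite (cvg_lim _ cv)|apply/cvg_ex; exists 0].
have /fine_cvgP[fin_d cv] : davg f x k.+1%:R^-1 @[k --> \oo] --> 0.
  by apply: limn_esup_le_cvg => // k; exact: davg_ge0.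
have small e : (0 < e)%R -> \forall r \near (0%R : R)^'+, davg f x r <= e%:E.
  move=> e0.
  have e20 : (0 < e / 2)%R by rewrite divr_gt0.
  have [K _ hK] : \forall k \near \oo, davg f x k.+1%:R^-1 <= (e / 2)%:E.
    move/cvgrPdist_le : cv => /(_ _ e20); apply: filterS2 fin_d => k kfin.
    rewrite sub0r normrN ger0_norm ?fine_ge0 ?davg_ge0// => h.
    by rewrite -(fineK kfin) lee_fin.
  near=> r.
  have r0 : (0 < r)%R by near: r; exact: nbhs_right_gt.
  have r1 : (r <= K.+1%:R^-1)%R by near: r; apply: nbhs_right_le; rewrite invr_gt0.
  have ri : (0 <= r^-1)%R by rewrite invr_ge0 ltW.
  (* The radius r is compared with 1/m, where m is the integer part of 1/r: m <= 1/r gives r <= 1/m,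
     and 1/r < m + 1 <= 2m gives 1/m <= 2r. The choice of r makes m - 1 >= K, and the factor 2 is
     absorbed by the bound e/2. *)
  have tr1 : (K.+1 <= Num.truncn r^-1)%N.
    by rewrite truncn_ge_nat// -(invrK K.+1%:R) lef_pV2 ?posrE ?invr_gt0.
  have /andP[kr rk] := truncn_itv ri.
  have k1 : (0 < Num.truncn r^-1)%N by exact: leq_trans tr1.
  have kE : (Num.truncn r^-1).-1.+1 = Num.truncn r^-1 by rewrite prednK.
  have k0 : (0 < (Num.truncn r^-1)%:R :> R)%R by rewrite ltr0n.
  apply: le_trans (@davg_le f x r (Num.truncn r^-1)%:R^-1 mf r0 _ _) _.
  - by rewrite -[leLHS]invrK lef_pV2 ?posrE ?invr_gt0.
  - rewrite -[leRHS]invrK lef_pV2 ?posrE ?invr_gt0 ?mulr_gt0// invfM.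
    rewrite ler_pdivrMl//; apply: (le_trans (ltW rk)).
    by rewrite -natrM ler_nat mul2n -addnn -addn1 leq_add2l.
  have := hK (Num.truncn r^-1).-1; rewrite /= kE -ltnS kE => /(_ tr1) h.
  rewrite (_ : e%:E = 2%:E * (e / 2)%:E) ?lee_wpmul2l//.
  by rewrite -EFinM mulrC divfK.
apply/fine_cvgP; split.
  apply: filterS (small 1%R ltr01) => r h.
  by rewrite ge0_fin_numE ?davg_ge0// (le_lt_trans h)// ltry.
apply/cvgrPdist_le => e e0; apply: filterS (small e e0) => r h.
have rfin : davg f x r \is a fin_num.
  by rewrite ge0_fin_numE ?davg_ge0// (le_lt_trans h)// ltry.
by rewrite sub0r normrN ger0_norm ?fine_ge0 ?davg_ge0// -lee_fin fineK.
Unshelve. all: by end_near. Qed.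

Lemma measurable_davg d (Y : measurableType d) (g : Y * measurableTypeR R -> R)
    (r : R) : measurable_fun setT g ->
  measurable_fun setT (fun p : Y * measurableTypeR R => davg (fun x => g (p.1, x)) p.2 r).
Proof.
move=> mg; have [r0|r0] := leP r 0%R.
  by under eq_fun do rewrite davg0//; exact: measurable_cst.
rewrite /davg /iavg.
under eq_fun do rewrite (lebesgue_measure_ball _ (ltW r0)).
apply: measurable_funeM.
(* The domain of integration moves with the centre; as an indicator it becomes part of an integrand
   measurable in all three variables, to which Tonelli applies. *)
pose h (p : (Y * measurableTypeR R) * measurableTypeR R) : \bar R :=
  (\1_[set p : (Y * measurableTypeR R) * measurableTypeR R |
         (`|p.1.2 - p.2| < r)%R] p * `|g (p.1.1, p.2) - g p.1|)%:E.
rewrite (_ : (fun _ => _) = fun p => \int[leb]_z h (p, z)).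
  apply: measurable_fun_fubini_tonelli_F.
  - apply/measurable_EFinP; apply: measurable_funM.
      apply: measurable_indic.
      rewrite -[X in measurable X]setTI.
      have mlt : measurable_fun setT
          (fun p : (Y * measurableTypeR R) * measurableTypeR R =>
            (`|p.1.2 - p.2| < r)%R).
        apply: measurable_fun_ltr; last exact: measurable_cst.
        apply: measurableT_comp => //; apply: measurable_funB.
          exact: (measurableT_comp measurable_snd measurable_fst).
        exact: measurable_snd.
      exact: (mlt measurableT [set true]).
    apply: measurableT_comp => //; apply: measurable_funB.
      apply: (measurableT_comp mg).
      apply/measurable_fun_pairP; split.
        exact: (measurableT_comp measurable_fst measurable_fst).
      exact: measurable_snd.
    exact: (measurableT_comp mg measurable_fst).
  - by move=> p; rewrite lee_fin mulr_ge0.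
apply/funext => -[y x] /=.
rewrite integral_mkcond; apply: eq_integral => z _.
rewrite /h patchE /= indicE; case: ifPn => [|] zb.
  by rewrite (_ : _ \in _ = true) ?mul1r//; move: zb; rewrite !inE.
rewrite (_ : _ \in _ = false) ?mul0r//; apply: contraNF zb.
by rewrite !inE.
Qed.

(** Almost every section is integrable, so Lebesgue differentiation makes the corresponding section
    of N null. Measurability of N allows its measure to be computed from its sections. *)
Lemma ae_lebesgue_pt d (Y : measurableType d)
    (rho : {sigma_finite_measure set Y -> \bar R})
    (g : Y * measurableTypeR R -> R) :
  (rho \x leb).-integrable setT (EFin \o g) ->
  let N := [set p : Y * measurableTypeR R |
    ~ lebesgue_pt (fun x => g (p.1, x)) p.2] in
  measurable N /\ (rho \x leb) N = 0.
Proof.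
move=> ig N.
have mg : measurable_fun setT g.
  by apply/measurable_EFinP; case/integrableP: ig.
have mgy y : measurable_fun setT (fun x : R => g (y, x)).
  exact: (measurableT_comp mg (pair1_measurable y)).
have mN : measurable N.
  rewrite (_ : N = ~` (setT `&` [set p : Y * measurableTypeR R |
      limn_esup (fun k => davg (fun x => g (p.1, x)) p.2 k.+1%:R^-1) <= 0])).
    apply/measurableC/emeasurable_fun_infty_c => //.
    by apply: measurable_fun_limn_esup => k; exact: measurable_davg.
  rewrite setTI; apply/seteqP; split=> p /=; apply: contra_not.
    by move/(lebesgue_ptP _ (mgy _)).
  by move/(lebesgue_ptP _ (mgy _)).
split=> //; rewrite /product_measure1.
rewrite (ae_eq_integral (cst 0)) ?integral0//.
  exact: measurable_fun_xsection.
apply: filterS (ae_integrable1 ig) => y igy _ /=.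
have : locally_integrable setT (fun x => g (y, x)).
  by apply: open_integrable_locally; [exact: openT|exact: igy].
move=> /lebesgue_differentiation[M [mM M0 subM]].
apply: subset_measure0 M0 => //; first exact: measurable_xsection.
by move=> x; rewrite /xsection/= inE /N/= => gyx; apply: subM.
Qed.

End lebesgue_points.

(** * Differentiating a weighted primitive in one variable *)

Section derivative_weighted.
Context {R : realType}.
Local Notation leb := (@lebesgue_measure R).

Lemma is_derive1P (F : R -> R) (a l : R) :
  (derivable F a 1 /\ derive1 F a = l) <->
  r^-1 *: (F (r + a) - F a) @[r --> 0^'] --> l.
Proof.
have E : (fun h : R => h^-1 *: ((F \o shift a) (h *: 1) - F a)) =
    (fun r => r^-1 *: (F (r + a) - F a)).
  by apply/funext => r /=; rewrite /GRing.scale/= mulr1.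
split=> [[/cvg_ex[/= l' Fl'] <-]|Fl].
  by rewrite E in Fl'; rewrite /derive1 (cvg_lim _ Fl').
split; first by apply/cvg_ex; exists l; rewrite E.
by apply/cvg_lim.
Qed.

Lemma Rintegral_indic_itv (f : R -> R) (x : R) :
  \int[leb]_y (\1_`[0, x] y * f y) = \int[leb]_(y in `[0, x]) f y.
Proof.
rewrite [RHS]Rintegral_mkcond; apply: eq_Rintegral => y _.
by rewrite patchE indicE; case: ifP => _; rewrite ?mul1r ?mul0r.
Qed.

Context d (S : measurableType d) (nu : {sigma_finite_measure set S -> \bar R}).
Variable g : S * measurableTypeR R -> R.
Hypothesis g0 : forall p, 0 <= g p.
Hypothesis ig : (product_measure1 nu leb).-integrable setT (EFin \o g).

Let mg : measurable_fun setT g.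
Proof. by apply/measurable_EFinP; case/integrableP: ig. Qed.

Let mgy y : measurable_fun setT (fun s => g (s, y)).
Proof. exact: (measurableT_comp mg (pair2_measurable y)). Qed.

Let W (w : S -> R) x (p : S * measurableTypeR R) := w p.1 * \1_`[0, x] p.2 * g p.

Let mW (w : S -> R) x : measurable_fun setT w -> measurable_fun setT (W w x).
Proof.
move=> mw; apply: measurable_funM => //; apply: measurable_funM.
  exact: (measurableT_comp mw measurable_fst).
have m1 : measurable_fun [set: measurableTypeR R] (\1_`[0, x] : R -> R).
  by apply: measurable_indic; exact: measurable_itv.
exact: (measurableT_comp m1 measurable_snd).
Qed.

Let W0 (w : S -> R) x p : (forall s, 0 <= w s <= 1) -> 0 <= W w x p <= g p.
Proof.
move=> w01; have /andP[w0 w1] := w01 p.1; rewrite /W -mulrA.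
have h : 0 <= \1_`[0, x] p.2 * g p <= g p.
  by rewrite mulr_ge0//= ler_piMl// indicE; case: (_ \in _).
have /andP[h0 h1] := h.
by rewrite mulr_ge0//=; apply: le_trans h1; rewrite ler_piMl.
Qed.

Let iW (w : S -> R) x : measurable_fun setT w -> (forall s, 0 <= w s <= 1) ->
  (product_measure1 nu leb).-integrable setT (EFin \o W w x).
Proof.
move=> mw w01; apply: le_integrable ig => //.
  by apply/measurable_EFinP; exact: mW.
move=> p _ /=; rewrite lee_fin; have /andP[W0p Wg] := W0 x p w01.
by rewrite ger0_norm// ger0_norm.
Qed.

Let H x s := \int[leb]_(y in `[0, x]) g (s, y).

Let H_W x s : H x s = \int[leb]_y W (cst 1) x (s, y).
Proof.
rewrite /H -(Rintegral_indic_itv (fun y => g (s, y))).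
by apply: eq_Rintegral => y _; rewrite /W mul1r.
Qed.

Let ae_igs : {ae nu, forall s, leb.-integrable setT (fun y => (g (s, y))%:E)}.
Proof. exact: (ae_integrable1 ig). Qed.

Let c01 (s : S) : 0 <= cst (1 : R) s <= 1. Proof. by rewrite ler01 lexx. Qed.

Let iH x : nu.-integrable setT (EFin \o H x).
Proof.
have iF := integrable_fubini_F (iW x (measurable_cst (1 : R)) c01).
have mF := measurable_int _ iF.
apply: le_integrable iF => //.
  apply/measurable_EFinP; rewrite (_ : H x = fine \o fubini_F leb (EFin \o W (cst 1) x)).
    by apply: measurableT_comp => //.
  by apply/funext => s; rewrite H_W.
move=> s _ /=; rewrite H_W /fubini_F /Rintegral /=.
by case: (integral _ _ _) => [r| |]//=; rewrite ?leey// normr0.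
Qed.

Let HE (w : S -> R) x : measurable_fun setT w -> (forall s, 0 <= w s <= 1) ->
  \int[product_measure1 nu leb]_p W w x p = \int[nu]_s (w s * H x s).
Proof.
move=> mw w01; rewrite /Rintegral -(integral12_prod_meas1 (iW x mw w01)).
congr fine; apply: ae_eq_integral => //.
- exact: measurable_int _ (integrable_fubini_F (iW x mw w01)).
- apply/measurable_EFinP/measurable_funM => //; apply/measurable_EFinP.
  exact: measurable_int _ (iH x).
apply: filterS ae_igs => s igs _; rewrite /fubini_F /= -/(H x s) H_W.
have i1 : leb.-integrable setT (EFin \o (fun y => W (cst 1) x (s, y))).
  apply: le_integrable igs => //.
    apply/measurable_EFinP.
    exact: (measurableT_comp (mW x (measurable_cst (1 : R))) (pair1_measurable s)).
  move=> y _ /=; rewrite lee_fin.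
  by have /andP[W0y Wg] := W0 x (s, y) c01; rewrite !ger0_norm.
rewrite -RintegralZl// /Rintegral fineK.
  by apply: eq_integral => y _; rewrite /W /= mul1r mulrA.
apply: integrable_fin_num => //.
exact: (integrableZl measurableT (w s) i1).
Qed.

Let Phi y := \int[nu]_s g (s, y).

Let iPhi : leb.-integrable setT (EFin \o Phi).
Proof.
have mG : measurable_fun setT (fubini_G nu (EFin \o g)) := measurable_fubini_G ig.
(* An inequality only: where the integral over s is infinite, [Phi] takes the default value 0. *)
have Phi_le y : (`|(EFin \o Phi) y| <= fubini_G nu (EFin \o g) y)%E.
  have : (0 <= fubini_G nu (EFin \o g) y)%E.
    by apply: integral_ge0 => s _; rewrite lee_fin.
  rewrite /Phi /fubini_G /Rintegral /=.
  case: (integral _ _ _) => [r| |]//=; rewrite ?leey ?normr0// => r0.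
  by rewrite ger0_norm.
apply/integrableP; split.
  apply/measurable_EFinP; rewrite (_ : Phi = fine \o fubini_G nu (EFin \o g))//.
  exact: measurableT_comp.
apply: (@le_lt_trans _ _ (\int[leb]_y fubini_G nu (EFin \o g) y)%E).
  apply: ge0_le_integral => //.
    apply: measurableT_comp => //; apply/measurable_EFinP.
    rewrite (_ : Phi = fine \o fubini_G nu (EFin \o g))//.
    exact: measurableT_comp.
rewrite (integral21_prod_meas1 ig).
by case/integrableP: ig => _; under eq_integral do rewrite /= ger0_norm//.
Qed.

(** Through this identity the convergence of the integrals of the difference quotients, which
    Scheffe's lemma asks for, is again differentiation at a Lebesgue point, now of [Phi]. *)
Let IHE x : \int[nu]_s H x s = \int[leb]_(y in `[0, x]) Phi y.
Proof.
under eq_Rintegral do rewrite -[H x _]mul1r.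
rewrite -(HE x (measurable_cst (1 : R)) c01) /Rintegral.
have i1 := iW x (measurable_cst (1 : R)) c01.
rewrite -(integral21_prod_meas1 i1) integral_mkcond; congr fine.
apply: ae_eq_integral => //.
- exact: measurable_fubini_G i1.
- apply: (measurable_restrict (EFin \o Phi) (measurable_itv _) measurableT).1.
  exact: measurable_funS measurableT (@subsetT _ _) (measurable_int _ iPhi).
apply: filterS (ae_integrable2 ig) => y igy _ /=; rewrite /fubini_G patchE.
case: ifPn => yx.
  rewrite /= /Phi /Rintegral fineK; last exact: integrable_fin_num.
  by apply: eq_integral => s _; rewrite /W /= mul1r indicE yx mul1r.
by rewrite integral0_eq// => s _; rewrite /W /= indicE (negbTE yx) mulr0 mul0r.
Qed.

Let H_nd s : leb.-integrable setT (fun y => (g (s, y))%:E) ->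
  {homo H^~ s : x y / x <= y}.
Proof.
move=> igs x y xy; rewrite /H.
rewrite [leLHS]Rintegral_mkcond [leRHS]Rintegral_mkcond.
have iI (z : R) : leb.-integrable setT (EFin \o ((fun t => g (s, t)) \_ `[0, z])).
  rewrite -restrict_EFin.
  apply: (integrable_mkcond (fun t => (g (s, t))%:E) (measurable_itv `[0, z])).1.
  apply: integrableS igs; [exact: measurableT|exact: measurable_itv|exact: subsetT].
apply: (le_Rintegral measurableT (iI x) (iI y)) => t _; rewrite !patchE.
case: ifPn => [|_]; last by case: ifP.
rewrite inE/= in_itv/= => /andP[t0 tx].
by rewrite mem_set//= in_itv/= t0 (le_trans tx).
Qed.

(** None of the conditions on a involves w. Lebesgue points of the sections give the pointwise limit
    of the difference quotients, a Lebesgue point of the integrated function gives the limit of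
    their integrals, and finiteness makes the limit function integrable. The exceptional set of a is
    thus chosen before the weight. *)
Lemma derivable_weighted_primitive (a : R) : 0 < a ->
  {ae nu, forall s, lebesgue_pt (fun x => g (s, x)) a} ->
  lebesgue_pt (fun x => \int[nu]_s g (s, x)) a ->
  (\int[nu]_s (g (s, a))%:E < +oo)%E ->
  forall w : S -> R, measurable_fun setT w -> (forall s, 0 <= w s <= 1) ->
  let K x := \int[product_measure1 nu leb]_p (w p.1 * \1_`[0, x] p.2 * g p) in
  derivable K a 1 /\ derive1 K a = \int[nu]_s (w s * g (s, a)).
Proof.
move=> a0 ga Phia gaoo w mw w01 K; apply/is_derive1P.
have KE x : K x = \int[nu]_s (w s * H x s) by exact: HE.
rewrite (_ : (fun r => _) = fun r => r^-1 *:
    (\int[nu]_s (w s * H (r + a) s) - \int[nu]_s (w s * H a s))); last first.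
  by apply/funext => r; rewrite !KE.
apply: derivative_under_integral_monotone => //.
- apply/integrableP; split; first exact/measurable_EFinP.
  by under eq_integral do rewrite /= ger0_norm//.
- by apply: filterS ae_igs; exact: H_nd.
- apply: filterS2 ae_igs ga => s igs lpt.
  apply: (is_derive1P (fun x => H x s) a (g (s, a))).1.
  (* The right end a + 1 is an arbitrary point beyond a. *)
  apply: (@FTC1_lebesgue_pt _ _ (BLeft 0) a (a + 1)) => //.
  + by rewrite ltrDl.
  + exact: integrableS igs.
- rewrite (_ : (fun r => _) = fun r => r^-1 *:
      (\int[leb]_(y in `[0, r + a]) Phi y - \int[leb]_(y in `[0, a]) Phi y)).
    apply: (is_derive1P (fun x => \int[leb]_(y in `[0, x]) Phi y) a (Phi a)).1.
    apply: (@FTC1_lebesgue_pt _ _ (BLeft 0) a (a + 1)) => //.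
    + by rewrite ltrDl.
    + exact: integrableS iPhi.
  by apply/funext => r; rewrite !IHE.
Qed.

End derivative_weighted.

(** * Products of sigma-finite measures and the reordering of their factors *)

Section sigma_finite_product.
Context d1 d2 (T1 : measurableType d1) (T2 : measurableType d2) (R : realType).
Variable m1 : {sigma_finite_measure set T1 -> \bar R}.
Variable m2 : {sigma_finite_measure set T2 -> \bar R}.
Local Open Scope ereal_scope.

(* The canonical sigma-finite structure on [m1 \x m2] is found only when [m1]
   and [m2] are subprobabilities; this alias carries the general one. *)
Definition sfprod : set (T1 * T2) -> \bar R := m1 \x m2.

Let sfprod0 : sfprod set0 = 0.
Proof. exact: (measure0 (m1 \x m2)). Qed.

Let sfprod_ge0 A : 0 <= sfprod A.
Proof. exact: (measure_ge0 (m1 \x m2)). Qed.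

Let sfprod_additive : semi_sigma_additive sfprod.
Proof. exact: (@measure_semi_sigma_additive _ _ _ (m1 \x m2)). Qed.

HB.instance Definition _ := isMeasure.Build _ _ _ sfprod
  sfprod0 sfprod_ge0 sfprod_additive.

Let sfprod_sigma_finite : sigma_finite setT sfprod.
Proof.
have /sigma_finiteP[F [TF ndF Foo]] := sigma_finiteT m1.
have /sigma_finiteP[G [TG ndG Goo]] := sigma_finiteT m2.
exists (fun k => F k `*` G k) => [|k].
  apply/esym/seteqP; split=> // -[x y] _.
  have [a _ Fx] : (\bigcup_k F k) x by rewrite -TF.
  have [b _ Gy] : (\bigcup_k G k) y by rewrite -TG.
  exists (maxn a b) => //; split.
  - by move: x Fx; exact/subsetPset/ndF/leq_maxl.
  - by move: y Gy; exact/subsetPset/ndG/leq_maxr.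
have [[mF Fk] [mG Gk]] := (Foo k, Goo k); split; first exact: measurableX.
by rewrite /sfprod product_measure1E// lte_mul_pinfty// ge0_fin_numE.
Qed.

HB.instance Definition _ := @Measure_isSigmaFinite.Build _ _ _ sfprod
  sfprod_sigma_finite.

End sigma_finite_product.

Section permuted_product.
Context d1 d2 d3 (T1 : measurableType d1) (T2 : measurableType d2)
  (T3 : measurableType d3) (R : realType).
Variable m1 : {sigma_finite_measure set T1 -> \bar R}.
Variable m2 : {sigma_finite_measure set T2 -> \bar R}.
Variable m3 : {sigma_finite_measure set T3 -> \bar R}.
Local Open Scope ereal_scope.

Lemma ae_prod2 (P : T2 -> Prop) : {ae m2, forall y, P y} ->
  {ae m1 \x m2, forall p, P p.2}.
Proof.
move=> [N [mN N0 subN]]; exists (setT `*` N); split.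
- exact: measurableX.
- by apply: etrans (product_measure1E _ _ measurableT mN) _; rewrite N0 mule0.
- by move=> p /= /subN.
Qed.

Lemma ae_prod_swap (N : set (T2 * T1)) : measurable N -> (m2 \x m1) N = 0 ->
  {ae m1 \x m2, forall p, ~ N (p.2, p.1)}.
Proof.
move=> mN N0.
have msw : measurable_fun setT (fun p : T1 * T2 => (p.2, p.1)).
  by apply/measurable_fun_pairP; split; [exact: measurable_snd|exact: measurable_fst].
have mN' : measurable [set p : T1 * T2 | N (p.2, p.1)].
  by rewrite -[X in measurable X]setTI; exact: msw.
exists [set p : T1 * T2 | N (p.2, p.1)]; split=> //; last by move=> p /= /contrapT.
rewrite -{}N0.
pose h (p : T1 * T2) : \bar R := (\1_N (p.2, p.1))%:E.
have mh : measurable_fun setT h.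
  by apply/measurable_EFinP; exact: (measurableT_comp (measurable_indic mN) msw).
have h0 p : 0 <= h p by rewrite lee_fin.
have mN1 : measurable_fun setT (fun p : T2 * T1 => (\1_N p)%:E : \bar R).
  by apply/measurable_EFinP; exact: measurable_indic.
have N10 (p : T2 * T1) : 0 <= (\1_N p)%:E :> \bar R by rewrite lee_fin.
transitivity (\int[m1 \x m2]_p h p).
  by rewrite -[in LHS](setIT [set p : T1 * T2 | _]) -integral_indic.
apply: etrans (fubini_tonelli2 (m1 := m1) (m2 := m2) h mh h0) _.
apply: etrans (esym (fubini_tonelli1 (m1 := m2) (m2 := m1) _ mN1 N10)) _.
by rewrite integral_indic// setIT.
Qed.

Let mperm : measurable_fun setT (fun p : T1 * (T3 * T2) => ((p.1, p.2.1), p.2.2)).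
Proof.
apply/measurable_fun_pairP; split.
  apply/measurable_fun_pairP; split; first exact: measurable_fst.
  exact: (measurableT_comp measurable_fst measurable_snd).
exact: (measurableT_comp measurable_snd measurable_snd).
Qed.

Lemma measurable_perm_integral (h : (T1 * T3) * T2 -> \bar R) :
  measurable_fun setT h -> (forall p, 0 <= h p) ->
  measurable_fun setT (fun q : T3 * T2 => \int[m1]_s h ((s, q.1), q.2)).
Proof.
move=> mh h0; have mh' := measurableT_comp mh mperm.
exact: (measurable_fun_fubini_tonelli_G (fun p => h (p.1, p.2.1, p.2.2)) mh').
Qed.

Lemma tonelli_perm (h : (T1 * T3) * T2 -> \bar R) : measurable_fun setT h ->
  (forall p, 0 <= h p) ->
  \int[m3 \x m2]_q \int[m1]_s h ((s, q.1), q.2) = \int[sfprod m1 m3 \x m2]_p h p.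
Proof.
move=> mh h0; have mk := measurable_perm_integral mh h0.
apply: etrans (fubini_tonelli2 (m1 := m3) (m2 := m2) _ mk _) _.
  by move=> q; exact: integral_ge0.
apply: (etrans _ (esym (fubini_tonelli2 (m1 := sfprod m1 m3) (m2 := m2) h mh h0))).
apply: eq_integral => u _; apply: esym.
have mhu := measurableT_comp mh (pair2_measurable u).
exact: (fubini_tonelli2 (m1 := m1) (m2 := m3) (fun p => h (p, u)) mhu (fun p => h0 _)).
Qed.

Lemma ge0_integral_prod_swap (h : T2 * T1 -> \bar R) : measurable_fun setT h ->
  (forall p, 0 <= h p) ->
  \int[m1 \x m2]_p h (p.2, p.1) = \int[m2 \x m1]_p h p.
Proof.
move=> mh h0.
have msw : measurable_fun setT (fun p : T1 * T2 => (p.2, p.1)).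
  by apply/measurable_fun_pairP; split; [exact: measurable_snd|exact: measurable_fst].
have mh' := measurableT_comp mh msw.
apply: etrans (fubini_tonelli2 (m1 := m1) (m2 := m2) _ mh' (fun p => h0 _)) _.
exact: esym (fubini_tonelli1 (m1 := m2) (m2 := m1) h mh h0).
Qed.

Lemma ge0_integral_prod_perm (h : (T1 * T3) * T2 -> \bar R) :
  measurable_fun setT h -> (forall p, 0 <= h p) ->
  \int[sfprod m1 m2 \x m3]_p h ((p.1.1, p.2), p.1.2) =
  \int[sfprod m1 m3 \x m2]_p h p.
Proof.
move=> mh h0.
have msw : measurable_fun setT (fun p : (T1 * T2) * T3 => ((p.1.1, p.2), p.1.2)).
  apply/measurable_fun_pairP; split.
    apply/measurable_fun_pairP; split; last exact: measurable_snd.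
    exact: (measurableT_comp measurable_fst measurable_fst).
  exact: (measurableT_comp measurable_snd measurable_fst).
have mh' := measurableT_comp mh msw.
have mF := measurable_fun_fubini_tonelli_F (m2 := m3) _ mh' (fun p => h0 _).
apply: (etrans _ (esym (fubini_tonelli2 (m1 := sfprod m1 m3) (m2 := m2) h mh h0))).
apply: etrans (fubini_tonelli1 (m1 := sfprod m1 m2) (m2 := m3) _ mh' (fun p => h0 _)) _.
apply: etrans (fubini_tonelli2 (m1 := m1) (m2 := m2) _ mF _) _.
  by move=> q; apply: integral_ge0 => x _; exact: h0.
apply: eq_integral => u _.
have mhu := measurableT_comp mh (pair2_measurable u).
exact: esym (fubini_tonelli1 (m1 := m1) (m2 := m3) (fun p => h (p, u)) mhu (fun p => h0 _)).
Qed.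

(** The indicator of N has integral 0 in every order of integration, and a nonnegative function of
    (x, u) with integral 0 vanishes almost everywhere. In N the differentiation variable x comes
    last, as for Lebesgue points; in the conclusion it comes first, as in a tuple. *)
Lemma ae_perm (N : set ((T1 * T2) * T3)) : measurable N ->
  (sfprod m1 m2 \x m3) N = 0 ->
  {ae m3 \x m2, forall q, {ae m1, forall s, ~ N ((s, q.2), q.1)}}.
Proof.
move=> mN N0.
pose h (p : (T1 * T3) * T2) : \bar R := (\1_N ((p.1.1, p.2), p.1.2))%:E.
have msw : measurable_fun setT (fun p : (T1 * T3) * T2 => ((p.1.1, p.2), p.1.2)).
  apply/measurable_fun_pairP; split.
    apply/measurable_fun_pairP; split; last exact: measurable_snd.
    exact: (measurableT_comp measurable_fst measurable_fst).
  exact: (measurableT_comp measurable_snd measurable_fst).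
have mh : measurable_fun setT h.
  by apply/measurable_EFinP; exact: (measurableT_comp (measurable_indic mN) msw).
have h0 p : 0 <= h p by rewrite lee_fin.
have : \int[m3 \x m2]_q \int[m1]_s h ((s, q.1), q.2) = 0.
  apply: etrans (tonelli_perm mh h0) _.
  apply: etrans (esym (ge0_integral_prod_perm mh h0)) _.
  rewrite (eq_integral (fun p => (\1_N p)%:E)) ?integral_indic// ?setIT//.
  by move=> [[s u] x] _.
set k := fun q => _.
have mk : measurable_fun setT k := measurable_perm_integral mh h0.
have k0 q : 0 <= k q by apply: integral_ge0.
move=> intk.
have /(ae_eq_integral_abs _ measurableT mk) : \int[m3 \x m2]_q `|k q| = 0.
  by under eq_integral do rewrite gee0_abs//.
apply: filterS => -[x u] /= /(_ I) kxu.
have msux : measurable_fun setT (fun s : T1 => ((s, u), x)).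
  by apply/measurable_fun_pairP; split; [exact: pair2_measurable|exact: measurable_cst].
have mNxu : measurable [set s | N (s, u, x)].
  by rewrite -[X in measurable X]setTI; exact: msux.
apply/negligibleP; rewrite setCK//.
rewrite -[LHS]mul1e; rewrite -kxu /k /h /=.
rewrite (eq_integral (fun s => (\1_[set s | N (s, u, x)] s)%:E)).
  by rewrite integral_indic// setIT mul1e.
by move=> s _; rewrite !indicE.
Qed.

End permuted_product.

(** * Splitting off the first coordinate of a tuple *)

Section cons_tuples.
Context {R : realType}.
Local Notation leb := (@lebesgue_measure R).

Lemma tnth_tuple_consS n x (u : n.-tuple R) i :
  tnth (tuple_cons (x, u)) (lift ord0 i) = tnth u i.
Proof. by rewrite /tuple_cons/= tnthS. Qed.

Lemma set_coord_cons0 n x y (u : n.-tuple R) :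
  set_coord (tuple_cons (x, u)) ord0 y = tuple_cons (y, u).
Proof.
apply: eq_from_tnth => i; rewrite tnth_set_coord.
by case: (unliftP ord0 i) => [j ->|->]; rewrite ?eqxx ?tnth_tuple_consS.
Qed.

Lemma set_coord_consS n x y (u : n.-tuple R) i :
  set_coord (tuple_cons (x, u)) (lift ord0 i) y = tuple_cons (x, set_coord u i y).
Proof.
apply: eq_from_tnth => j; rewrite tnth_set_coord.
case: (unliftP ord0 j) => [k ->|->].
  by rewrite !tnth_tuple_consS tnth_set_coord (inj_eq lift_inj).
by rewrite (negbTE (neq_lift _ _)).
Qed.

Lemma partials_cons n (s : seq 'I_n) (F : n.+1.-tuple R -> R) x u :
  partials [seq lift ord0 i | i <- s] F (tuple_cons (x, u)) =
  partials s (fun v => F (tuple_cons (x, v))) u.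
Proof.
elim: s u => [//|i s IH] u /=; rewrite tnth_tuple_consS; congr (derive1 _ _).
by apply/funext => y; rewrite set_coord_consS IH.
Qed.

Lemma has_partials_cons n (s : seq 'I_n) (F : n.+1.-tuple R -> R) x u :
  has_partials s (fun v => F (tuple_cons (x, v))) u ->
  has_partials [seq lift ord0 i | i <- s] F (tuple_cons (x, u)).
Proof.
elim: s u => [//|i s IH] u /= [hn hd]; rewrite tnth_tuple_consS; split.
  by apply: filterS hn => y hy; rewrite set_coord_consS; exact: IH.
rewrite (_ : (fun y => _) =
    fun y => partials s (fun v => F (tuple_cons (x, v))) (set_coord u i y))//.
by apply/funext => y; rewrite set_coord_consS partials_cons.
Qed.

Lemma measurable_tuple_consR n :
  measurable_fun [set: measurableTypeR R * n.-tuple R] (@tuple_cons R n).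
Proof.
apply/measurable_fun_tnthP => i /=.
case: (unliftP ord0 i) => [j ->|->].
  rewrite (_ : _ \o _ = fun p : R * n.-tuple R => tnth p.2 j).
    exact: (measurableT_comp (measurable_tnth j) measurable_snd).
  by apply/funext => -[x u] /=; rewrite tnth_tuple_consS.
exact: measurable_fst.
Qed.

Lemma ge0_integral_cons n (h : n.+1.-tuple R -> \bar R) :
  measurable_fun setT h -> (forall t, 0 <= h t)%E ->
  (\int[lebesgue_tuple R n.+1]_t h t =
   \int[product_measure1 leb (lebesgue_tuple R n)]_p h (tuple_cons p))%E.
Proof.
move=> mh h0.
have := @ge0_integral_pushforward _ _ _ _ _ _ (@measurable_tuple_consR n)
  (product_measure1 leb (lebesgue_tuple R n)) setT h measurableT mh.
by rewrite preimage_setT => <-.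
Qed.

Lemma ae_cons n (P : n.+1.-tuple R -> Prop) :
  {ae product_measure1 leb (lebesgue_tuple R n), forall p, P (tuple_cons p)} ->
  {ae lebesgue_tuple R n.+1, forall t, P t}.
Proof.
move=> [N [mN N0 subN]].
pose h (t : n.+1.-tuple R) : measurableTypeR R * n.-tuple R :=
  (tnth t ord0, [tuple of behead t]).
have mh : measurable_fun setT h.
  apply/measurable_fun_pairP; split; first exact: measurable_tnth.
  exact: measurable_behead.
have hK p : h (tuple_cons p) = p by case: p => x u; congr (_, _); apply/val_inj.
have Kh t : tuple_cons (h t) = t by rewrite [RHS]tuple_eta; apply/val_inj.
exists (h @^-1` N); split.
- by rewrite -[X in measurable X]setTI; exact: mh.
- rewrite -[LHS]/(product_measure1 leb (lebesgue_tuple R n)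
    (@tuple_cons R n @^-1` (h @^-1` N))).
  by rewrite (_ : _ @^-1` _ = N)//; apply/seteqP; split=> p /=; rewrite hK.
- by move=> t /= Pt; apply: subN => /=; rewrite Kh.
Qed.

Context d (S : measurableType d) (nu : {sigma_finite_measure set S -> \bar R}).

Lemma measurable_prod_cons n : measurable_fun
  [set: (S * measurableTypeR R) * n.-tuple R]
  (fun p => (p.1.1, tuple_cons (p.1.2, p.2)) : S * n.+1.-tuple R).
Proof.
apply/measurable_fun_pairP; split.
  exact: (measurableT_comp measurable_fst measurable_fst).
apply: (measurableT_comp (@measurable_tuple_consR n)).
apply/measurable_fun_pairP; split; last exact: measurable_snd.
exact: (measurableT_comp measurable_snd measurable_fst).
Qed.

Lemma ge0_integral_prod_cons n (h : S * n.+1.-tuple R -> \bar R) :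
  measurable_fun setT h -> (forall t, 0 <= h t)%E ->
  (\int[product_measure1 nu (lebesgue_tuple R n.+1)]_p h p =
   \int[product_measure1 (sfprod nu leb) (lebesgue_tuple R n)]_p
      h (p.1.1, tuple_cons (p.1.2, p.2)))%E.
Proof.
move=> mh h0; have mh' := measurableT_comp mh (@measurable_prod_cons n).
apply: etrans (fubini_tonelli1 (m1 := nu) (m2 := lebesgue_tuple R n.+1) h mh h0) _.
apply: (etrans _ (esym (fubini_tonelli1 (m1 := sfprod nu leb)
  (m2 := lebesgue_tuple R n) _ mh' _))); last by move=> p; exact: h0.
have mF := measurable_fun_fubini_tonelli_F (m2 := lebesgue_tuple R n) _ mh' (fun p => h0 _).
apply: (etrans _ (esym (fubini_tonelli1 (m1 := nu) (m2 := leb) _ mF _))); last first.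
  by move=> p; apply: integral_ge0 => t _; exact: h0.
apply: eq_integral => s _; rewrite /fubini_F.
have mhs := measurableT_comp mh (pair1_measurable s).
apply: etrans (ge0_integral_cons mhs (fun t => h0 _)) _.
have mhc := measurableT_comp mhs (@measurable_tuple_consR n).
exact: (fubini_tonelli1 (m1 := leb) (m2 := lebesgue_tuple R n) _ mhc (fun p => h0 _)).
Qed.

End cons_tuples.

(** * Iterated derivatives of primitives *)

Section ae_mixed_partial.
Context {R : realType}.
Local Notation leb := (@lebesgue_measure R).

Lemma measurable_box0 n (u : n.-tuple R) : measurable (box0 u).
Proof.
rewrite (_ : box0 u = box (fun i => `[0, tnth u i]%classic)).
  by apply: measurable_box => i; exact: measurable_itv.
by apply/seteqP; split=> t /= h i; have := h i; rewrite /= in_itv.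
Qed.

Lemma indic_box0_cons n (x y : R) (u t : n.-tuple R) :
  \1_(box0 (tuple_cons (x, u))) (tuple_cons (y, t)) =
  \1_`[0, x] y * \1_(box0 u) t :> R.
Proof.
rewrite !indicE -natrM mulnb; congr (_%:R); congr nat_of_bool.
apply/idP/andP; rewrite !inE /= in_itv/=.
  move=> h; split; first exact: (h ord0).
  by move=> i; have := h (lift ord0 i); rewrite !tnth_tuple_consS.
move=> [hx hu] i; case: (unliftP ord0 i) => [j ->|->]//.
by rewrite !tnth_tuple_consS.
Qed.

(* The statement is uniform in the weight [w] so that the induction, which
   peels off the first coordinate, can absorb the indicator of [0, x] for all
   x at once: the inner derivatives are needed at every x near u_1. *)
Lemma ae_mixed_partial_weighted n d (S : measurableType d)
    (nu : {sigma_finite_measure set S -> \bar R}) (f : S * n.-tuple R -> R) :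
  (forall p, 0 <= f p) ->
  (product_measure1 nu (lebesgue_tuple R n)).-integrable setT (EFin \o f) ->
  {ae lebesgue_tuple R n, forall u, (forall i, 0 < tnth u i) ->
    forall w : S -> R, measurable_fun setT w -> (forall s, 0 <= w s <= 1) ->
    let F v := \int[product_measure1 nu (lebesgue_tuple R n)]_p
                 (w p.1 * \1_(box0 v) p.2 * f p) in
    has_mixed_partial F u /\ mixed_partial F u = \int[nu]_s (w s * f (s, u))}.
Proof.
elim: n d S nu f => [|n IH] d S nu f f0 if_.
  have mf : measurable_fun setT f by apply/measurable_EFinP; case/integrableP: if_.
  apply: aeW => u _ w mw w01; rewrite /has_mixed_partial /mixed_partial.
  (* With no coordinates the mixed partial is F itself and Lebesgue measure is a Dirac mass, so the
     claim is an instance of Tonelli. *)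
  rewrite (_ : enum 'I_0 = [::])/=; last by apply/size0nil; rewrite size_enum_ord.
  split=> //; rewrite /Rintegral; congr fine.
  pose h (p : S * 0.-tuple R) := (w p.1 * \1_(box0 u) p.2 * f p)%:E.
  have mh : measurable_fun setT h.
    apply/measurable_EFinP/measurable_funM => //; apply: measurable_funM.
      exact: (measurableT_comp mw measurable_fst).
    have m1 := @measurable_indic _ _ R setT _ (measurable_box0 u).
    exact: (measurableT_comp m1 measurable_snd).
  have h0 p : (0 <= h p)%E.
    by rewrite lee_fin !mulr_ge0//; have /andP[] := w01 p.1.
  apply: etrans (fubini_tonelli1 (m1 := nu) (m2 := lebesgue_tuple R 0) h mh h0) _.
  apply: eq_integral => s _; rewrite /fubini_F /=.
  rewrite integral_dirac//; last exact: (measurableT_comp mh (pair1_measurable s)).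
  rewrite diracT mul1e /h /= (tuple0 u) indicE mem_set ?mulr1//.
  by move=> i; case: i.
have mf : measurable_fun setT f by apply/measurable_EFinP; case/integrableP: if_.
(* The first coordinate joins the parameter: the induction hypothesis is used for the other n
   coordinates with parameter space S x R. *)
pose f' (p : (S * measurableTypeR R) * n.-tuple R) :=
  f (p.1.1, tuple_cons (p.1.2, p.2)).
have mf' : measurable_fun setT f' := measurableT_comp mf (@measurable_prod_cons R _ S n).
have f'0 p : 0 <= f' p by exact: f0.
have if' : (product_measure1 (sfprod nu leb) (lebesgue_tuple R n)).-integrable setT
    (EFin \o f').
  apply/integrableP; split; first exact/measurable_EFinP.
  case/integrableP: if_ => _.
  rewrite ge0_integral_prod_cons//; last by do 2 apply: measurableT_comp => //.
(* The exceptional sets: [E1] and [E2] concern u alone, while [E3], [E4] and [E5] are the conditions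
   of [derivable_weighted_primitive] on y, for almost every pair (y, u). *)
have E1 := IH _ _ (sfprod nu leb) f' f'0 if'.
have E2 := ae_integrable2 (m1 := sfprod nu leb) (m2 := lebesgue_tuple R n) if'.
(* Reordered so that the variable of differentiation comes last and u belongs to the parameter. *)
pose g (q : (S * n.-tuple R) * measurableTypeR R) := f' ((q.1.1, q.2), q.1.2).
have mh' : measurable_fun setT (EFin \o f') by exact/measurable_EFinP.
have h'0 p : (0 <= (f' p)%:E)%E by rewrite lee_fin.
have if'oo : (\int[product_measure1 (sfprod nu leb) (lebesgue_tuple R n)]_p
    (f' p)%:E < +oo)%E.
  by case/integrableP: if' => _; under eq_integral do rewrite /= ger0_norm//.
have mg : measurable_fun setT g.
  apply: (measurableT_comp mf'); apply/measurable_fun_pairP; split.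
    apply/measurable_fun_pairP; split; last exact: measurable_snd.
    exact: (measurableT_comp measurable_fst measurable_fst).
  exact: (measurableT_comp measurable_snd measurable_fst).
have ig : (product_measure1 (sfprod nu (lebesgue_tuple R n)) leb).-integrable setT
    (EFin \o g).
  apply/integrableP; split; first exact/measurable_EFinP.
  under eq_integral do rewrite /= ger0_norm ?f'0//.
  by rewrite (ge0_integral_prod_perm nu (lebesgue_tuple R n) leb mh' h'0).
have E3 : {ae product_measure1 leb (lebesgue_tuple R n), forall q,
    {ae nu, forall s, lebesgue_pt (fun x => f' ((s, x), q.2)) q.1}}.
  have [mN N0] := ae_lebesgue_pt ig.
  apply: filterS (ae_perm mN N0) => q; apply: filterS => s.
  exact: contrapT.
pose k (q : measurableTypeR R * n.-tuple R) :=
  (\int[nu]_s (f' ((s, q.1), q.2))%:E)%E.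
have mk : measurable_fun setT k := measurable_perm_integral nu mh' h'0.
have k0 q : (0 <= k q)%E by exact: integral_ge0.
have ik : (product_measure1 leb (lebesgue_tuple R n)).-integrable setT k.
  apply/integrableP; split=> //.
  under eq_integral do rewrite gee0_abs//.
  by rewrite (tonelli_perm nu (lebesgue_tuple R n) leb mh' h'0).
have E4 : {ae product_measure1 leb (lebesgue_tuple R n), forall q,
    lebesgue_pt (fun x => \int[nu]_s f' ((s, x), q.2)) q.1}.
  pose Phi (p : n.-tuple R * measurableTypeR R) := \int[nu]_s f' ((s, p.2), p.1).
  have msw : measurable_fun setT
      (fun p : n.-tuple R * measurableTypeR R => (p.2, p.1)).
    by apply/measurable_fun_pairP; split; [exact: measurable_snd|exact: measurable_fst].
  have iPhi : (product_measure1 (lebesgue_tuple R n) leb).-integrable setT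
      (EFin \o Phi).
    have mk' := measurableT_comp mk msw.
    have mPhi : measurable_fun setT Phi.
      rewrite (_ : Phi = fine \o (k \o (fun p => (p.2, p.1))))//.
      exact: measurableT_comp.
    apply/integrableP; split.
      exact/measurable_EFinP.
    case/integrableP: ik => _; under eq_integral do rewrite gee0_abs//.
    rewrite -(ge0_integral_prod_swap (lebesgue_tuple R n) leb mk k0).
    apply: le_lt_trans; apply: ge0_le_integral => //.
      by apply: measurableT_comp => //; exact/measurable_EFinP.
    move=> [v x] _; rewrite /= /Phi /Rintegral /= -/(k (x, v)).
    by case: (k (x, v)) (k0 (x, v)) => [r r0| |]//=; rewrite ?leey// ger0_norm.
  have [mN N0] := ae_lebesgue_pt iPhi.
  apply: filterS (ae_prod_swap (m1 := leb) (m2 := lebesgue_tuple R n) mN N0) => q.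
  exact: contrapT.
have E5 : {ae product_measure1 leb (lebesgue_tuple R n), forall q,
    (\int[nu]_s (f' ((s, q.1), q.2))%:E < +oo)%E}.
  apply: filterS (integrable_ae measurableT ik) => q /(_ I).
  by rewrite ge0_fin_numE.
apply: ae_cons.
have ae_filter :=
  ae_filter_ringOfSetsType (product_measure1 leb (lebesgue_tuple R n)).
apply: filterS3 (ae_prod2 leb (filterI E1 E2)) E3 (filterI E4 E5).
move=> [y u] [good1 iu] good3 [good4 good5] yu_gt0 w mw w01.
set F := (X in has_mixed_partial X _).
have y0 : 0 < y by exact: (yu_gt0 ord0).
have u0 i : 0 < tnth u i by have := yu_gt0 (lift ord0 i); rewrite tnth_tuple_consS.
pose w' x (p : S * measurableTypeR R) := w p.1 * \1_`[0, x] p.2.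
have mw' x : measurable_fun setT (w' x).
  apply: measurable_funM; first exact: (measurableT_comp mw measurable_fst).
  have m1 : measurable_fun [set: measurableTypeR R] (\1_`[0, x] : R -> R).
    by apply: measurable_indic; exact: measurable_itv.
  exact: (measurableT_comp m1 measurable_snd).
have w'01 x p : 0 <= w' x p <= 1.
  have /andP[w0 w1] := w01 p.1; rewrite /w' mulr_ge0//=.
  by rewrite indicE; case: (_ \in _); rewrite ?mulr1 ?mulr0.
have FE x : (fun v => F (tuple_cons (x, v))) = fun v =>
    \int[product_measure1 (sfprod nu leb) (lebesgue_tuple R n)]_p
      (w' x p.1 * \1_(box0 v) p.2 * f' p).
  apply/funext => v; rewrite /F /Rintegral ge0_integral_prod_cons.
  - congr fine; apply: eq_integral => -[[s z] t] _ /=.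
    by rewrite indic_box0_cons /w' /= mulrA.
  - apply/measurable_EFinP/measurable_funM => //; apply: measurable_funM.
      exact: (measurableT_comp mw measurable_fst).
    have m1 := @measurable_indic _ _ R setT _ (measurable_box0 (tuple_cons (x, v))).
    exact: (measurableT_comp m1 measurable_snd).
  - by move=> p; rewrite lee_fin !mulr_ge0//; have /andP[] := w01 p.1.
rewrite /has_mixed_partial /mixed_partial enum_ordSl.
(* The point u is fixed before the weight, so the same u serves for every x, and the inner
   derivatives exist at all x and not just near y. *)
have good x := good1 u0 (w' x) (mw' x) (w'01 x).
have PE : (fun x => partials [seq lift ord0 i | i <- enum 'I_n] F
      (set_coord (tuple_cons (y, u)) ord0 x)) =
    fun x => \int[product_measure1 nu leb]_p (w p.1 * \1_`[0, x] p.2 * f' (p, u)).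
  apply/funext => x; rewrite set_coord_cons0 partials_cons FE.
  by have [_] := good x.
have [dK dKE] := @derivable_weighted_primitive R _ S nu (fun p => f' (p, u))
  (fun p => f'0 _) iu y y0 good3 good4 good5 w mw w01.
rewrite /= PE; split; last exact: dKE.
split; last exact: dK.
apply: filterE => x; rewrite set_coord_cons0; apply: has_partials_cons.
by rewrite FE; have [] := good x.
Qed.

End ae_mixed_partial.

Section mixed_partial_density.
Context {R : realType} {n : nat}.
Implicit Types (F G f : n.-tuple R -> R) (u v : n.-tuple R).

Lemma near_open_unit_cube u (i : 'I_n) : open_unit_cube R n u ->
  \forall x \near tnth u i, open_unit_cube R n (set_coord u i x).
Proof.
move=> hu; have : \forall x \near tnth u i, x \in `]0, 1[.
  by apply: near_in_itvoo; rewrite in_itv/=; exact: hu.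
apply: filterS => x; rewrite in_itv/= => x01 j; rewrite tnth_set_coord.
by case: ifP => // _; exact: hu.
Qed.

(** C is prescribed on the cube only, while the derivatives are computed from functions on all of
    R^n. The open cube contains a neighbourhood of each of its points along every axis, so the
    values inside determine the iterated derivatives there. *)
Lemma eq_partials_open_cube (s : seq 'I_n) F G :
  (forall v, open_unit_cube R n v -> F v = G v) ->
  forall u, open_unit_cube R n u ->
  partials s F u = partials s G u /\ (has_partials s G u -> has_partials s F u).
Proof.
move=> FG; elim: s => [|i s IH] u hu /=; first by split=> //; exact: FG.
have nFG : {near tnth u i, (fun x => partials s F (set_coord u i x)) =1
    (fun x => partials s G (set_coord u i x))}.
  near=> x; have hx : open_unit_cube R n (set_coord u i x).
    by near: x; exact: near_open_unit_cube.
  by have [] := IH _ hx.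
split; first by rewrite !derive1E; exact: near_eq_derive.
move=> [hn hd]; split; last first.
  apply: near_eq_derivable hd; rewrite ?oner_neq0//.
  by near do apply/esym; exact: nFG.
near=> x; have hx : open_unit_cube R n (set_coord u i x).
  by near: x; exact: near_open_unit_cube.
by have [_] := IH _ hx; apply; near: x; exact: hn.
Unshelve. all: by end_near. Qed.

Lemma ae_mixed_partial_primitive f C :
  (forall t, 0 <= f t) -> (lebesgue_tuple R n).-integrable setT (EFin \o f) ->
  (forall u, open_unit_cube R n u ->
    (C u)%:E = (\int[lebesgue_tuple R n]_(t in box0 u) (f t)%:E)%E) ->
  {ae lebesgue_tuple R n, forall u, open_unit_cube R n u ->
    has_mixed_partial C u /\ f u = mixed_partial C u}.
Proof.
move=> f0 if_ Cf.
have mf : measurable_fun setT f by apply/measurable_EFinP; case/integrableP: if_.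
(* A one-point parameter space with the weight 1 turns the weighted statement into the plain one. *)
pose nu : {sigma_finite_measure set unit -> \bar R} := \d_tt.
have int1 (h : unit * n.-tuple R -> R) : measurable_fun setT h ->
    (forall p, 0 <= h p) ->
    (\int[product_measure1 nu (lebesgue_tuple R n)]_p (h p)%:E =
     \int[lebesgue_tuple R n]_t (h (tt, t))%:E)%E.
  move=> mh h0; have mh' : measurable_fun setT (EFin \o h) by exact/measurable_EFinP.
  have h'0 p : (0 <= (EFin \o h) p)%E by rewrite lee_fin.
  apply: etrans (fubini_tonelli1 (m1 := nu) (m2 := lebesgue_tuple R n) _ mh' h'0) _.
  by rewrite integral_dirac// diracT mul1e.
have mf2 : measurable_fun setT (fun p : unit * n.-tuple R => f p.2).
  exact: (measurableT_comp mf measurable_snd).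
have if2 : (product_measure1 nu (lebesgue_tuple R n)).-integrable setT
    (EFin \o (fun p => f p.2)).
  apply/integrableP; split; first exact/measurable_EFinP.
  under eq_integral do rewrite /= ger0_norm//.
  rewrite int1//; case/integrableP: if_ => _.
  by under eq_integral do rewrite /= ger0_norm//.
have := ae_mixed_partial_weighted (fun p => f0 p.2) if2.
apply: filterS => u good hu.
have u0 i : 0 < tnth u i by have /andP[] := hu i.
have c01 (s : unit) : 0 <= cst (1 : R) s <= 1 by rewrite ler01 lexx.
have [] := good u0 (cst 1) (measurable_cst _) c01.
set F := (X in has_mixed_partial X _).
have CF v : open_unit_cube R n v -> C v = F v.
  move=> hv; rewrite /F /Rintegral int1.
  - rewrite -[LHS]/(fine (C v)%:E) Cf// integral_mkcond; congr fine.
    apply: eq_integral => t _; rewrite patchE indicE mul1r.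
    by case: ifP => _; rewrite ?mul1r ?mul0r.
  - apply: measurable_funM => //; apply: measurable_funM => //.
    have m1 := @measurable_indic _ _ R setT _ (measurable_box0 v).
    exact: (measurableT_comp m1 measurable_snd).
  - by move=> p; rewrite mul1r mulr_ge0.
have [CFu hCF] := eq_partials_open_cube (enum 'I_n) CF hu.
move=> hF FE; split; first exact: hCF.
rewrite [RHS]CFu -/(mixed_partial F u) FE /Rintegral integral_dirac//.
by rewrite diracT mul1e mul1r.
Qed.

End mixed_partial_density.

Section density.
Context d (T : measurableType d) (R : realType).
Variables (m : {measure set T -> \bar R}) (f : T -> R).

(** The hypotheses are arguments of the definition so that the probability structure can be attached
    to it. *)
Definition density_prob of (forall t, 0 <= f t) & measurable_fun setT f &
    (\int[m]_t (f t)%:E = 1)%E : set T -> \bar R :=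
  fun B => (\int[m]_(t in B) (f t)%:E)%E.

Variables (f0 : forall t, 0 <= f t) (mf : measurable_fun setT f).
Hypothesis f1 : (\int[m]_t (f t)%:E = 1)%E.
Local Notation mu := (density_prob f0 mf f1).

Let density0 : mu set0 = 0%E.
Proof. exact: integral_set0. Qed.

Let density_ge0 B : (0 <= mu B)%E.
Proof. by apply: integral_ge0 => t _; rewrite lee_fin. Qed.

Let density_additive : semi_sigma_additive mu.
Proof.
move=> /= F mF tF mUF; rewrite /density_prob; apply: cvg_toP.
  apply: ereal_nondecreasing_is_cvgn => i j ij.
  apply: lee_sum_nneg_natr => // k _ _.
  by apply: integral_ge0 => t _; rewrite lee_fin.
rewrite ge0_integral_bigcup//=.
- by apply/measurable_EFinP/measurable_funTS.
- by move=> t _; rewrite lee_fin.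
Qed.

HB.instance Definition _ := isMeasure.Build _ _ _ mu
  density0 density_ge0 density_additive.

HB.instance Definition _ := @Measure_isProbability.Build _ _ R mu f1.

End density.

(** * Sufficiency *)

Section centered.
Context {R : realType} {n : nat} (Q : probability (n.-tuple R) R).
Hypothesis hQ : uniform_on_cube Q.
Local Notation leb := (@lebesgue_measure R).
Local Notation unif := (@uniform01_prob R).
Implicit Types (t : n.-tuple R) (A : {set 'I_n}) (i : 'I_n).

Lemma measurable_resample i (h : n.-tuple R -> \bar R) :
  Q.-integrable setT h ->
  measurable_fun setT
    (fun t => \int[leb]_(x in `[0%R, 1%R]) h (set_coord t i x))%E.
Proof.
move=> ih; have mh := measurable_int _ ih.
have mhk := measurableT_comp mh (@measurable_set_coord R n i).
have /(integrable_law (@measurable_set_coord R n i) (set_coord_law hQ i) mh) ihk := ih.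
rewrite (_ : (fun t => _) = fubini_G unif (fun p => h (set_coord p.2 i p.1))).
  exact: measurable_fubini_G ihk.
apply/funext => t; rewrite /fubini_G -integral_uniform_prob01//.
exact: (measurableT_comp mhk (pair2_measurable t)).
Qed.

(** Resample coordinate i. Membership in D does not change, so the inner integral is either the
    integral of h in coordinate i, which vanishes, or that of 0. *)
Lemma integral_centered i (h : n.-tuple R -> R) (D : set (n.-tuple R)) :
  measurable D -> (forall t x, D (set_coord t i x) <-> D t) ->
  Q.-integrable setT (EFin \o h) ->
  {ae Q, forall t,
    (\int[leb]_(x in `[0%R, 1%R]) (h (set_coord t i x))%:E = 0)%E} ->
  (\int[Q]_(t in D) (h t)%:E = 0)%E.
Proof.
move=> mD Di ih h0; rewrite integral_mkcond.
have ihD : Q.-integrable setT ((EFin \o h) \_ D).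
  by apply/(integrable_mkcond _ mD); exact: integrableS ih.
rewrite (integral_resample hQ i ihD).
rewrite (ae_eq_integral (cst 0%E)) ?integral0//; first exact: measurable_resample.
apply: filterS h0 => t ht _ /=.
have [Dt|nDt] := pselect (D t).
  rewrite -[RHS]ht; apply: eq_integral => x _; rewrite patchE mem_set//.
  exact/Di.
rewrite integral0_eq// => x _; rewrite patchE memNset//.
by move=> /Di.
Qed.

Lemma subtuple_set_coord A t (k : 'I_#|A|) x :
  subtuple A (set_coord t (enum_val k) x) = set_coord (subtuple A t) k x.
Proof.
apply: eq_from_tnth => j; rewrite tnth_mktuple !tnth_set_coord.
by rewrite (inj_eq enum_val_inj) tnth_mktuple.
Qed.

(** How c >= 2 enters the computation of the marginals: a constraint on coordinate i alone leaves
    another coordinate of A free to be integrated out. *)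
Lemma exists_enum_val_neq A i : (2 <= #|A|)%N ->
  exists k : 'I_#|A|, enum_val k != i.
Proof.
move=> A2; have /card_gt0P[j] : (0 < #|A :\ i|)%N.
  by have := cardsD1 i A; case: (i \in A) => /= e; move: A2; rewrite e; case: #|_|.
rewrite !inE => /andP[ji jA]; exists (enum_rank_in jA j).
by rewrite enum_rankK_in.
Qed.

Lemma uniform_on_cube_coord i (B : set R) : measurable B ->
  Q ((fun t => tnth t i) @^-1` B) = unif B.
Proof.
move=> mB; rewrite (_ : _ @^-1` _ = box (fun j => if j == i then B else setT)).
  rewrite hQ; last by move=> j; case: ifP.
  rewrite (bigD1 i)//= eqxx big1 ?mule1// => j /negbTE ->.
  by rewrite probability_setT.
apply/seteqP; split=> t /=; first by move=> Bt j; case: eqP => // ->.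
by move=> /(_ i); rewrite eqxx.
Qed.

(** The coordinates in A are themselves uniform on a cube, of dimension #|A|, so the integrability
    condition on g_A is Q-integrability of its summand in U. *)
Lemma integrable_subtuple A (h : #|A|.-tuple R -> R) : measurable_fun setT h ->
  (\int[lebesgue_tuple R #|A|]_(t in unit_cube R #|A|) `|(h t)%:E| < +oo)%E <->
  Q.-integrable setT (EFin \o (h \o subtuple A)).
Proof.
move=> mh; have mh' : measurable_fun setT (EFin \o h) by exact/measurable_EFinP.
have mA := @measurable_subtuple R n A.
pose QA : probability (#|A|.-tuple R) R :=
  distribution Q (MeasurableFun.Pack (MeasurableFun.Class
    (isMeasurableFun.Build _ _ _ _ _ mA))).
have lawA : has_law Q (subtuple A) QA by [].
have hQA := uniform_on_cube_subtuple hQ lawA.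
rewrite -(setTI (unit_cube R #|A|)) -(integral_uniform_on_cube hQA)//; last first.
  exact: measurableT_comp.
split=> [h_oo|].
  apply: (integrable_law mA lawA mh').1; apply/integrableP; split=> //.
by move/(integrable_law mA lawA mh') => /integrableP[].
Qed.

End centered.

Section sufficiency.
Context (R : realType) (n : nat) (Q : probability (n.-tuple R) R).
Hypothesis hQ : uniform_on_cube Q.
Local Notation leb := (@lebesgue_measure R).
Local Notation unif := (@uniform01_prob R).
Variable g : forall A : {set 'I_n}, #|A|.-tuple R -> R.
Arguments g : clear implicits.
Hypothesis mg : forall A : {set 'I_n}, (2 <= #|A|)%N -> measurable_fun setT (g A).
Hypothesis ig : forall A : {set 'I_n}, (2 <= #|A|)%N ->
  Q.-integrable setT (EFin \o (g A \o subtuple A)).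
Hypothesis g0 : forall (A : {set 'I_n}) (k : 'I_#|A|), (2 <= #|A|)%N ->
  {ae Q, forall t,
    (\int[leb]_(x in `[0%R, 1%R]) (g A (set_coord (subtuple A t) k x))%:E = 0)%E}.
Hypothesis gN1 : {ae Q, forall t, -1 <= U_tilde g t}.

Lemma measurable_U_tilde : measurable_fun setT (U_tilde g).
Proof.
rewrite /U_tilde; under eq_fun do rewrite big_mkcond.
apply: measurable_sum => A; have [A2|_] := boolP (1 < #|A|)%N; last exact: measurable_cst.
exact: (measurableT_comp (mg A2) (@measurable_subtuple R n A)).
Qed.

(** The constant 1 contributes the uniform law of coordinate i. Every g_A is centered in some
    coordinate other than i, hence contributes 0. *)
Lemma integral_coord_U_tilde (i : 'I_n) (B : set R) : measurable B ->
  (\int[Q]_(t in (fun t => tnth t i) @^-1` B) (1 + U_tilde g t)%:E = unif B)%E.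
Proof.
move=> mB; set D := _ @^-1` B.
have mD : measurable D.
  by rewrite -[X in measurable X]setTI; exact: (@measurable_tnth _ _ n i).
have igD (A : {set 'I_n}) : Q.-integrable D
    (fun t => (if (1 < #|A|)%N then g A (subtuple A t) else 0)%:E).
  by have [A2|_] := boolP (1 < #|A|)%N; [exact: integrableS (ig A2)|exact: integrable0].
under eq_integral do rewrite EFinD /U_tilde big_mkcond -sumEFin.
rewrite integralD//; last 2 first.
- exact: finite_measure_integrable_cst.
- by apply: integrable_sum => // A _; exact: igD.
rewrite integral_cst// mul1e integral_sum//.
rewrite big1 ?adde0; first exact: uniform_on_cube_coord.
move=> A _; have [A2|_] := boolP (1 < #|A|)%N; last exact: integral0.
have [k ki] := exists_enum_val_neq i A2.
apply: (integral_centered hQ (i := enum_val k) mD) (ig A2) _.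
  by move=> t x; rewrite /D /= tnth_set_coord eq_sym (negbTE ki).
have aeQ := ae_filter_ringOfSetsType Q.
by apply: filterS (g0 k A2) => t; under eq_integral do rewrite -subtuple_set_coord.
Qed.

Lemma copula_of_U_tilde (C : n.-tuple R -> R) : (0 < n)%N ->
  (forall u, unit_cube R n u -> (C u)%:E =
    (\int[lebesgue_tuple R n]_(t in box0 u) (1 + U_tilde g t)%:E)%E) ->
  absolutely_continuous_copula C.
Proof.
move=> n0 CE; have mC := @measurable_unit_cube R n; have mU := measurable_U_tilde.
(* The lower bound on U holds only almost everywhere on the cube. Cutting to the cube and truncating
   at 0 makes the density nonnegative everywhere and changes no integral against Q. *)
pose f t := \1_(unit_cube R n) t * Num.max 0 (1 + U_tilde g t).
have f_ge0 t : 0 <= f t by rewrite mulr_ge0// le_max lexx.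
have mm : measurable_fun setT (fun t => Num.max 0 (1 + U_tilde g t)).
  by apply: measurable_maxr => //; exact: measurable_funD.
have mf : measurable_fun setT f.
  by apply: measurable_funM => //; exact: measurable_indic.
have fE B : measurable B -> (\int[lebesgue_tuple R n]_(t in B) (f t)%:E =
    \int[Q]_(t in B) (1 + U_tilde g t)%:E)%E.
  move=> mB.
  transitivity (\int[Q]_(t in B) (Num.max 0 (1 + U_tilde g t))%:E)%E; last first.
    apply: ae_eq_integral => //.
    - by apply/measurable_EFinP; exact: measurable_funTS.
    - by apply/measurable_EFinP/measurable_funTS/measurable_funD.
    apply: filterS gN1 => t tN1 _; rewrite max_r//.
    by rewrite -lerBlDl sub0r.
  rewrite (integral_uniform_on_cube hQ mB) ?integral_mkcondr; last exact/measurable_EFinP.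
  apply: eq_integral => t _; rewrite /f indicE patchE.
  by case: ifP => _; rewrite ?mul1r ?mul0r.
have coordE (i : 'I_n) B : measurable B ->
    (\int[lebesgue_tuple R n]_(t in (fun t => tnth t i) @^-1` B) (f t)%:E = unif B)%E.
  move=> mB; rewrite fE ?integral_coord_U_tilde//.
  by rewrite -[X in measurable X]setTI; exact: (@measurable_tnth _ _ n i).
have f1 : (\int[lebesgue_tuple R n]_t (f t)%:E = 1)%E.
  have := coordE (Ordinal n0) setT measurableT.
  by rewrite preimage_setT probability_setT.
have if_ : (lebesgue_tuple R n).-integrable setT (EFin \o f).
  apply/integrableP; split; first exact/measurable_EFinP.
  under eq_integral do rewrite /= ger0_norm//.
  by rewrite f1 ltry.
pose P : probability (n.-tuple R) R := density_prob f_ge0 mf f1.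
pose X (i : 'I_n) : {RV P >-> R} := MeasurableFun.Pack (MeasurableFun.Class
    (isMeasurableFun.Build _ _ _ _ _ (@measurable_tnth _ R n i))).
have CE' u : unit_cube R n u ->
    (C u)%:E = (\int[lebesgue_tuple R n]_(t in box0 u) (f t)%:E)%E.
  move=> hu; rewrite CE// fE; last exact: measurable_box0.
  rewrite (integral_uniform_on_cube hQ (measurable_box0 u)); last first.
    by apply/measurable_EFinP/measurable_funD.
  rewrite setIidl// => t ht i; have /andP[-> tu] := ht i.
  by have /andP[_] := hu i; exact: le_trans.
exists _, _, P, X, f; split.
- split=> [i B mB|u hu]; first exact: coordE.
  rewrite CE'//.
  (* The event of the cdf is a lower orthant; it differs from [box0 u] only outside the cube, where
     f is 0. *)
  pose L := [set t : n.-tuple R | forall i, tnth t i <= tnth u i].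
  rewrite -[RHS]/(\int[lebesgue_tuple R n]_(t in L) (f t)%:E)%E.
  rewrite [LHS]integral_mkcond [RHS]integral_mkcond; apply: eq_integral => t _.
  rewrite !patchE /f indicE; have [tC|_] := boolP (t \in unit_cube R n); last first.
    by rewrite /= mul0r; do 2 case: ifP.
  congr (if _ then _ else _); apply/idP/idP; rewrite !inE /= => h i.
    by have /andP[] := h i.
  by rewrite h andbT; move: tC; rewrite inE => /(_ i)/andP[].
- split=> // B mB.
  rewrite -[LHS]/(\int[lebesgue_tuple R n]_(t in joint X @^-1` B) (f t)%:E)%E.
  congr (integral _ _ _); apply/seteqP; split=> t /=; rewrite (_ : joint X t = t)//.
    by apply: eq_from_tnth => i; rewrite tnth_mktuple.
  by apply: eq_from_tnth => i; rewrite tnth_mktuple.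
- apply: ae_mixed_partial_primitive => // u hu; apply: CE' => i.
  by have /andP[/ltW -> /ltW] := hu i.
Qed.

End sufficiency.

(** * Necessity *)

Section alternating_sums.
Context {R : realType} {n : nat}.
Implicit Types (A B : {set 'I_n}) (k : 'I_n).

Definition toggle k A := if k \in A then A :\ k else k |: A.

Lemma toggleK k : involutive (toggle k).
Proof.
move=> A; rewrite /toggle; have [kA|kA] := boolP (k \in A).
  by rewrite finset.setD11 finset.setD1K.
by rewrite finset.setU11 finset.setU1K.
Qed.

(** Toggling the membership of k is an involution that changes the sign of phi, so the sum equals
    its own negative. *)
Lemma alternating_sum0 k (phi : {set 'I_n} -> R) :
  (forall A, k \notin A -> phi (k |: A) = - phi A) -> \sum_A phi A = 0.
Proof.
move=> phik; have phit A : phi (toggle k A) = - phi A.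
  rewrite /toggle; case: ifP => kA; last by rewrite phik ?kA.
  by rewrite -[in RHS](finset.setD1K kA) phik ?opprK// finset.setD11.
have E : \sum_A phi A = - \sum_A phi A.
  rewrite [LHS](reindex_inj (inv_inj (toggleK k))) -sumrN.
  by apply: eq_bigr => A _; exact: phit.
by lra.
Qed.

(** B and B with k added have opposite signs and the same c. Since integrating over coordinate k
    turns f_B into f_(B \ k), this cancellation is what centers the Hoeffding terms. *)
Lemma signed_subset_sum0 A k (c : {set 'I_n} -> R) : k \in A ->
  \sum_(B : {set 'I_n} | B \subset A) (-1) ^+ #|A :\: B| * c (B :\ k) = 0.
Proof.
move=> kA; rewrite big_mkcond; apply: (@alternating_sum0 k) => B kB.
rewrite finset.subUset finset.sub1set kA /= finset.setU1K//.
case: ifP => // _; last by rewrite oppr0.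
rewrite (_ : B :\ k = B); last first.
  by apply/finset.setDidPl; rewrite disjoint_sym disjoints1.
rewrite -mulNr; congr (_ * _).
rewrite [#|A :\: B|](cardsD1 k) finset.in_setD kB kA /= exprS mulN1r opprK.
by congr (_ ^+ _); apply: eq_card => i; rewrite !inE; case: (i == k).
Qed.

(** After exchanging the sums, the coefficient of a proper subset B is a signed count of the sets A
    containing it; these cancel in pairs that differ by some k outside B. *)
Lemma mobius_subset_sum (m : {set 'I_n} -> R) :
  \sum_(A : {set 'I_n}) \sum_(B : {set 'I_n} | B \subset A) (-1) ^+ #|A :\: B| * m B =
  m [set: 'I_n]%SET.
Proof.
under eq_bigr do rewrite big_mkcond.
rewrite exchange_big (bigD1 [set: 'I_n]%SET)//= [X in _ + X]big1 ?addr0 => [|B BT].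
  rewrite (bigD1 [set: 'I_n]%SET)//= subxx finset.setDv cards0 expr0 mul1r.
  rewrite big1 ?addr0// => A AT; rewrite ifF//.
  by apply/negP; rewrite finset.subTset; exact/negP.
have [k kB] : exists k, k \notin B.
  apply/existsP; rewrite -negb_forall; apply: contra BT => /forallP h.
  by apply/eqP/setP => i; rewrite h inE.
apply: (@alternating_sum0 k) => A kA.
have -> : (B \subset k |: A) = (B \subset A).
  apply/idP/idP => [BkA|BA]; last exact: fintype.subset_trans (finset.subsetUr _ _).
  apply/fintype.subsetP => i iB; have := fintype.subsetP BkA i iB.
  by rewrite !inE => /orP[/eqP ik|//]; rewrite -ik iB in kB.
case: ifP => _; last by rewrite oppr0.
rewrite -mulNr; congr (_ * _).
rewrite [#|(k |: A) :\: B|](cardsD1 k) finset.in_setD kB finset.setU11 /= exprS mulN1r.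
congr (- _ ^+ _); apply: eq_card => i; rewrite !inE; case: eqP => //= ->.
by rewrite (negbTE kA) andbF.
Qed.

End alternating_sums.

(** * Marginals of the density and its Hoeffding terms *)

Section hoeffding.
Context (R : realType) (n : nat) (Q : probability (n.-tuple R) R).
Hypothesis hQ : uniform_on_cube Q.
Local Notation leb := (@lebesgue_measure R).
Local Notation unif := (@uniform01_prob R).
Variable f : n.-tuple R -> R.
Hypotheses (f0 : forall t, 0 <= f t) (mf : measurable_fun setT f).
Hypothesis f_coord : forall (i : 'I_n) (B : set R), measurable B ->
  (\int[Q]_(t in (fun t => tnth t i) @^-1` B) (f t)%:E = unif B)%E.
Hypothesis n0 : (0 < n)%N.
Implicit Types (t v : n.-tuple R) (A B : {set 'I_n}).

(** The marginal on the coordinates in A, kept as a function of the whole tuple so that all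
    marginals share one domain. It may be infinite on a null set. *)
Definition marg A t : \bar R := (\int[Q]_v (f (merge A t v))%:E)%E.

Let mEf : measurable_fun setT (EFin \o f).
Proof. exact/measurable_EFinP. Qed.

Let mfA A := measurableT_comp mEf (@measurable_merge R n A).

Lemma integral_density1 : (\int[Q]_t (f t)%:E = 1)%E.
Proof.
have := f_coord (Ordinal n0) measurableT.
by rewrite preimage_setT probability_setT.
Qed.

Lemma marg_ge0 A t : (0 <= marg A t)%E.
Proof. by apply: integral_ge0 => v _; rewrite lee_fin. Qed.

Lemma measurable_marg A : measurable_fun setT (marg A).
Proof.
exact: (measurable_fun_fubini_tonelli_F (m2 := Q) _ (mfA A) (fun p => f0 _)).
Qed.

Lemma integral_marg A : (\int[Q]_t marg A t = 1)%E.
Proof.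
rewrite -integral_density1; apply: esym.
exact: (ge0_integral_merge hQ A mEf (fun t => f0 t)).
Qed.

Lemma integrable_marg A : Q.-integrable setT (marg A).
Proof.
apply/integrableP; split; first exact: measurable_marg.
under eq_integral do rewrite gee0_abs ?marg_ge0//.
by rewrite integral_marg ltry.
Qed.

Lemma measurable_fine_marg A : measurable_fun setT (fun t => fine (marg A t)).
Proof. exact: (measurableT_comp (fine_measurable measurableT) (measurable_marg A)). Qed.

Lemma integrable_fine_marg A : Q.-integrable setT (EFin \o (fun t => fine (marg A t))).
Proof.
apply: le_integrable (integrable_marg A) => //.
  by apply/measurable_EFinP; exact: measurable_fine_marg.
move=> t _ /=; case: (marg A t) => [r| |] //=; by rewrite normr0 leey.
Qed.

Lemma ae_marg_fin_num : {ae Q, forall t, forall A, marg A t \is a fin_num}.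
Proof.
apply: filter_forall => A.
by apply: filterS (integrable_ae measurableT (integrable_marg A)) => t; apply.
Qed.

Lemma eq_marg A t t' : {in A, tnth t =1 tnth t'} -> marg A t = marg A t'.
Proof.
move=> tt'; apply: eq_integral => v _; congr (f _)%:E.
by apply: eq_from_tnth => i; rewrite !tnth_mktuple; case: ifP => // /tt'.
Qed.

(** Resample coordinate k of v and exchange the integrals. As f is nonnegative this holds at every
    t, infinite values included. *)
Lemma integral_marg_set_coord A (k : 'I_n) t : k \in A ->
  (\int[unif]_x marg A (set_coord t k x) = marg (A :\ k) t)%E.
Proof.
move=> kA; apply: esym.
have mk : measurable_fun setT (fun v => (f (merge (A :\ k) t v))%:E).
  exact: (measurableT_comp (mfA (A :\ k)) (pair1_measurable t)).
rewrite /marg (ge0_integral_resample hQ k mk); last by move=> v; rewrite lee_fin.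
have mkx := measurableT_comp mk (@measurable_set_coord R n k).
transitivity (\int[Q]_v \int[unif]_x (f (merge (A :\ k) t (set_coord v k x)))%:E)%E.
  apply: eq_integral => v _; rewrite -integral_uniform_prob01//.
  exact: (measurableT_comp mkx (pair2_measurable v)).
apply: etrans (esym (fubini_tonelli (m1 := unif) (m2 := Q) _ mkx (fun p => f0 _))) _.
apply: eq_integral => x _; apply: eq_integral => v _ /=; congr (f _)%:E.
apply: eq_from_tnth => i; rewrite !tnth_mktuple !inE.
by case: (eqVneq i k) => [->|_]; rewrite ?kA.
Qed.

Definition hoeffding A t : R :=
  \sum_(B : {set 'I_n} | B \subset A) (-1) ^+ #|A :\: B| * fine (marg B t).

Lemma measurable_hoeffding A : measurable_fun setT (hoeffding A).
Proof.
rewrite /hoeffding; under eq_fun do rewrite big_mkcond.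
apply: measurable_sum => B; have [_|_] := boolP (B \subset A); last exact: measurable_cst.
by apply: measurable_funM; [exact: measurable_cst|exact: measurable_fine_marg].
Qed.

Lemma integrable_hoeffding A : Q.-integrable setT (EFin \o hoeffding A).
Proof.
rewrite (_ : EFin \o _ = fun t => (\sum_(B : {set 'I_n} | B \subset A)
    ((-1) ^+ #|A :\: B| * fine (marg B t))%:E)%E); last first.
  by apply/funext => t; rewrite /= sumEFin.
apply: integrable_sum => // B _.
exact: (integrableZl measurableT _ (integrable_fine_marg B)).
Qed.

Lemma eq_hoeffding A t t' : {in A, tnth t =1 tnth t'} ->
  hoeffding A t = hoeffding A t'.
Proof.
move=> tt'; apply: eq_bigr => B BA; rewrite (@eq_marg B t t')// => i iB.
by apply: tt'; exact: (fintype.subsetP BA).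
Qed.

(** At a t where all marginals are finite, each f_B is integrable along coordinate k, because that
    integral is the finite number [marg (B :\ k) t]. The signed sum of these numbers cancels. *)
Lemma ae_hoeffding_centered A (k : 'I_n) : k \in A ->
  {ae Q, forall t,
    (\int[leb]_(x in `[0%R, 1%R]) (hoeffding A (set_coord t k x))%:E = 0)%E}.
Proof.
move=> kA; apply: filterS ae_marg_fin_num => t tfin.
have mset : measurable_fun setT (fun x => set_coord t k x).
  exact: (measurableT_comp (@measurable_set_coord R n k) (pair2_measurable t)).
rewrite -integral_uniform_prob01; last first.
  by apply/measurable_EFinP; exact: (measurableT_comp (measurable_hoeffding A) mset).
have mB B : measurable_fun setT (fun x => fine (marg B (set_coord t k x))).
  exact: (measurableT_comp (measurable_fine_marg B) mset).
have int_marg B : (\int[unif]_x marg B (set_coord t k x) = marg (B :\ k) t)%E.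
  have [kB|kB] := boolP (k \in B); first exact: integral_marg_set_coord.
  rewrite (eq_integral (fun=> marg (B :\ k) t)).
    rewrite integral_cst//; apply: etrans (mule1 _); congr (_ * _)%E.
    exact: (@probability_setT _ _ _ unif).
  move=> x _; rewrite (_ : B :\ k = B).
    apply: eq_marg => i iB; rewrite tnth_set_coord ifF//.
    by apply: contraNF kB => /eqP <-.
  by apply/finset.setDidPl; rewrite disjoint_sym disjoints1.
have iB B : unif.-integrable setT (fun x => marg B (set_coord t k x)).
  apply/integrableP; split; first exact: (measurableT_comp (measurable_marg B) mset).
  under eq_integral do rewrite gee0_abs ?marg_ge0//.
  by rewrite int_marg -ge0_fin_numE ?marg_ge0.
have ifB B : unif.-integrable setT (EFin \o (fun x => fine (marg B (set_coord t k x)))).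
  apply: le_integrable (iB B) => //; first exact/measurable_EFinP.
  move=> x _ /=; case: (marg B _) => [r| |] //=; by rewrite normr0 leey.
rewrite (eq_integral (fun x => (\sum_(B : {set 'I_n} | B \subset A)
    ((-1) ^+ #|A :\: B| * fine (marg B (set_coord t k x)))%:E)%E)); last first.
  by move=> x _; rewrite sumEFin.
rewrite integral_sum//; last first.
  by move=> B; exact: (integrableZl measurableT _ (ifB B)).
rewrite (eq_bigr (fun B => ((-1) ^+ #|A :\: B| * fine (marg (B :\ k) t))%:E)).
  by rewrite sumEFin (signed_subset_sum0 (fun B => fine (marg B t)) kA).
move=> B _; under eq_integral do rewrite EFinM.
rewrite (integralZl measurableT (ifB B)) EFinM fineK//; congr (_ * _)%E.
rewrite -int_marg; apply: ae_eq_integral => //.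
- exact/measurable_EFinP.
- exact: (measurableT_comp (measurable_marg B) mset).
by apply: filterS (integrable_ae measurableT (iB B)) => x /(_ I) /fineK.
Qed.

Lemma sum_hoeffding t : \sum_A hoeffding A t = f t.
Proof.
rewrite mobius_subset_sum /marg (eq_integral (cst (f t)%:E)).
  rewrite integral_cst// -[RHS]/(fine (f t)%:E) -[in RHS](mule1 (f t)%:E).
  by congr (fine (_ * _)%E); exact: (@probability_setT _ _ _ Q).
move=> v _; congr (f _)%:E; apply: eq_from_tnth => i.
by rewrite tnth_mktuple inE.
Qed.

Lemma marg_set0 t : marg finset.set0 t = 1%E.
Proof.
rewrite -integral_density1; apply: eq_integral => v _; congr (f _)%:E.
by apply: eq_from_tnth => i; rewrite tnth_mktuple inE.
Qed.

(** This marginal is a function of one real variable that has the same uniform integral as the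
    constant 1 over every Borel set. *)
Lemma ae_marg_set1 i : {ae Q, forall t, marg [set i]%SET t = 1%E}.
Proof.
(* Any tuple with i-th entry x would do, as the marginal depends on that entry alone. *)
pose cs (x : R) : n.-tuple R := [tuple x | _ < n].
pose phi x := marg [set i]%SET (cs x).
have phiE t : marg [set i]%SET t = phi (tnth t i).
  by apply: eq_marg => j; rewrite inE => /eqP ->; rewrite tnth_mktuple.
have mcs : measurable_fun setT cs.
  apply/measurable_fun_tnthP => j; rewrite (_ : _ \o _ = id)//.
  by apply/funext => x /=; rewrite tnth_mktuple.
have mphi : measurable_fun setT phi := measurableT_comp (measurable_marg _) mcs.
have phi0 x : (0 <= phi x)%E by exact: marg_ge0.
have mi := @measurable_tnth _ R n i.
have intB (B : set R) : measurable B -> (\int[unif]_(x in B) phi x = unif B)%E.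
  move=> mB; have mB' : measurable ((fun t : n.-tuple R => tnth t i) @^-1` B).
    by rewrite -[X in measurable X]setTI; exact: mi.
  transitivity (\int[Q]_(t in (fun t => tnth t i) @^-1` B) marg [set i]%SET t)%E.
    rewrite [RHS](eq_integral (phi \o (fun t => tnth t i))); last first.
      by move=> t _; rewrite phiE.
    rewrite -(ge0_integral_pushforward mi Q mB)//; last exact: measurable_funTS.
    by apply: eq_measure_integral => C mC _; apply/esym/uniform_on_cube_coord.
  rewrite -(f_coord i mB) [LHS]integral_mkcond [RHS]integral_mkcond.
  set D := _ @^-1` B.
  have mfD : measurable_fun setT ((EFin \o f) \_ D).
    by apply: (measurable_restrictT _ mB').1; exact: measurable_funTS.
  rewrite [RHS](ge0_integral_merge hQ [set i]%SET mfD); last first.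
    by move=> t; rewrite patchE; case: ifP => // _; rewrite lee_fin.
  apply: eq_integral => t _; rewrite patchE.
  have Dm v : (merge [set i]%SET t v \in D) = (t \in D).
    by apply/idP/idP; rewrite !inE /D /= tnth_mktuple inE eqxx.
  case: ifPn => tD; first by apply: eq_integral => v _; rewrite patchE Dm tD.
  by rewrite integral0_eq// => v _; rewrite patchE Dm (negbTE tD).
have [N [mN N0 subN]] : ae_eq unif setT phi (cst 1%E).
  apply: integral_ae_eq => //.
    apply/integrableP; split=> //; under eq_integral do rewrite gee0_abs//.
    by rewrite intB// probability_setT ltry.
  by move=> B _ mB; rewrite intB// integral_cst// mul1e.
exists ((fun t : n.-tuple R => tnth t i) @^-1` N); split.
- by rewrite -[X in measurable X]setTI; exact: mi.
- by rewrite uniform_on_cube_coord.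
- by move=> t /= ht; apply: subN => /= h; apply: ht; rewrite phiE h.
Qed.

Lemma ae_sum_hoeffding_ge2 : {ae Q, forall t,
  1 + \sum_(A : {set 'I_n} | (2 <= #|A|)%N) hoeffding A t = f t}.
Proof.
have : {ae Q, forall t, forall i, marg [set i]%SET t = 1%E}.
  by apply: filter_forall => i; exact: ae_marg_set1.
apply: filterS => t marg1.
rewrite -[RHS]sum_hoeffding [RHS](bigID (fun A : {set 'I_n} => (2 <= #|A|)%N))/=.
rewrite addrC; congr (_ + _); apply: esym.
have h0 : hoeffding finset.set0 t = 1.
  rewrite /hoeffding (big_pred1 finset.set0) => [|B]; last by rewrite finset.subset0.
  by rewrite finset.setDv cards0 expr0 mul1r marg_set0.
rewrite (bigD1 finset.set0)/=; last by rewrite cards0.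
rewrite h0 big1 ?addr0// => A /andP[]; rewrite -leqNgt => A1 A0.
have /cards1P[i ->] : #|A| == 1%N by rewrite eqn_leq A1 card_gt0.
rewrite /hoeffding (bigD1 [set i]%SET)//= finset.setDv cards0 expr0 mul1r marg1.
rewrite (big_pred1 finset.set0) => [|B].
  by rewrite finset.setD0 cards1 expr1 mulN1r marg_set0 subrr.
rewrite finset.subset1; case: (eqVneq B [set i]%SET) => [->|_]; rewrite ?andbT//=.
by apply/esym/negbTE; rewrite -card_gt0 cards1.
Qed.

(** For i outside A, [index] equals #|A| and [nth] returns its default 0; the Hoeffding term of A
    does not see these coordinates. *)
Definition extend A (s : #|A|.-tuple R) : n.-tuple R :=
  [tuple nth 0 s (index i (enum A)) | i < n].

Lemma tnth_extend_subtuple A t : {in A, tnth (extend (subtuple A t)) =1 tnth t}.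
Proof.
move=> i iA; rewrite tnth_mktuple.
have iA' : (index i (enum A) < #|A|)%N by rewrite cardE index_mem mem_enum.
rewrite -(tnth_nth 0 (subtuple A t) (Ordinal iA')) tnth_mktuple; congr tnth.
by rewrite (enum_val_nth i)/= nth_index// mem_enum.
Qed.

Lemma measurable_extend A : measurable_fun setT (@extend A).
Proof.
apply/measurable_fun_tnthP => i /=.
have [iA|iA] := ltnP (index i (enum A)) #|A|.
  rewrite (_ : _ \o _ = fun s : #|A|.-tuple R => tnth s (Ordinal iA)).
    exact: measurable_tnth.
  by apply/funext => s /=; rewrite tnth_mktuple (tnth_nth 0).
rewrite (_ : _ \o _ = cst 0); first exact: measurable_cst.
by apply/funext => s /=; rewrite tnth_mktuple nth_default// size_tuple.
Qed.

Definition hoeffding_term A (s : #|A|.-tuple R) : R := hoeffding A (extend s).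

Lemma hoeffding_term_subtuple A t : hoeffding_term (subtuple A t) = hoeffding A t.
Proof. by apply: eq_hoeffding; exact: tnth_extend_subtuple. Qed.

Lemma measurable_hoeffding_term A : measurable_fun setT (@hoeffding_term A).
Proof. exact: (measurableT_comp (measurable_hoeffding A) (@measurable_extend A)). Qed.

End hoeffding.

(** * Conditional expectation given all coordinates of A but one *)

Section conditioning.
Context d (T : measurableType d) (R : realType) (P : probability T R) (n : nat).
Variable V : 'I_n -> {RV P >-> R}.
Variable Q : probability (n.-tuple R) R.
Hypothesis VQ : has_law P (joint V) Q.
Hypothesis hQ : uniform_on_cube Q.
Local Notation leb := (@lebesgue_measure R).
Local Notation unif := (@uniform01_prob R).
Variables (A : {set 'I_n}) (k : 'I_#|A|) (h : #|A|.-tuple R -> R).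
Hypothesis mh : measurable_fun setT h.
Hypothesis ih : Q.-integrable setT (EFin \o (h \o subtuple A)).
Hypothesis h0 : {ae Q, forall t,
  (\int[leb]_(x in `[0%R, 1%R]) (h (set_coord (subtuple A t) k x))%:E = 0)%E}.

Let VA w := subtuple A (joint V w).
Let I w := (\int[leb]_(x in `[0%R, 1%R]) (h (set_coord (VA w) k x))%:E)%E.
Let J s := (\int[leb]_(x in `[0%R, 1%R]) (h (set_coord s k x))%:E)%E.
Let W (j : 'I_#|A|.-1) : T -> R := V (enum_val (lift k j)).
Let G : set (set T) := g_sigma_preimage W.
(* The coordinates generating [G]; the k-th one is frozen. *)
Let theta w := set_coord (VA w) k 0.

Let mV := measurable_joint V.

(** The integral is by definition the difference of the integrals of positive and negative parts,
    each measurable by Tonelli. Measurability thus holds on the whole space, as an exact version of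
    the conditional expectation requires. *)
Let mJ : measurable_fun setT J.
Proof.
have mEh : measurable_fun setT (EFin \o h) by exact/measurable_EFinP.
have mhk := measurableT_comp mEh (@measurable_set_coord R _ k).
pose F (p : R * #|A|.-tuple R) : \bar R := (h (set_coord p.2 k p.1))%:E.
have mF : measurable_fun setT F := mhk.
rewrite (_ : J = fubini_G unif F^\+ \- fubini_G unif F^\-)%E.
  apply: emeasurable_funB; apply: measurable_fun_fubini_tonelli_G => //.
    exact: measurable_funepos.
  exact: measurable_funeneg.
apply/funext => s; rewrite /J -integral_uniform_prob01.
  rewrite integralE /fubini_G; congr (_ - _)%E; apply: eq_integral => x _.
    by rewrite !funeposE.
  by rewrite !funenegE.
exact: (measurableT_comp mhk (pair2_measurable s)).
Qed.

Let set_coord_set_coord m (t : m.-tuple R) i x y :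
  set_coord (set_coord t i x) i y = set_coord t i y.
Proof. by apply: eq_from_tnth => j; rewrite !tnth_set_coord; case: (j == i). Qed.

Let I_theta w : I w = J (theta w).
Proof. by apply: eq_integral => x _; rewrite set_coord_set_coord. Qed.

Let generators_sub : G `<=` preimage_set_system setT theta measurable.
Proof.
apply: smallest_sub.
  exact/sigma_algebra_preimage/sigma_algebra_measurable.
move=> E; rewrite -bigcup_seq/= => -[j _ [B mB <-]].
exists ((fun s => tnth s (lift k j)) @^-1` B).
  by rewrite -[X in measurable X]setTI; exact: measurable_tnth.
apply/seteqP; split=> w /=.
  by move=> [_]; rewrite tnth_set_coord eq_sym (negbTE (neq_lift _ _)) !tnth_mktuple; split.
by move=> [_]; rewrite tnth_set_coord eq_sym (negbTE (neq_lift _ _)) !tnth_mktuple; split.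
Qed.

Let preimage_theta D : measurable D -> G (theta @^-1` D).
Proof.
move=> mD; rewrite -[_ @^-1` _]setTI.
have sG : sigma_algebra setT G by exact: smallest_sigma_algebra.
apply: (smallest_sub (sigma_algebra_image theta sG) _ mD) => E.
rewrite -bigcup_seq/= => -[i _ [B mB <-]]; rewrite /image_set_system /= !setTI.
have [j ->|->] := unliftP k i.
  apply: sub_sigma_algebra; rewrite -bigcup_seq/=; exists j.
    by rewrite /= mem_index_enum.
  exists B => //; apply/seteqP; split=> w /=.
    by move=> [_]; rewrite tnth_set_coord eq_sym (negbTE (neq_lift _ _)) !tnth_mktuple.
  by rewrite tnth_set_coord eq_sym (negbTE (neq_lift _ _)) !tnth_mktuple; split.
have [B0|B0] := pselect (B 0).
  rewrite (_ : _ @^-1` _ = setT); last first.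
    by apply/seteqP; split=> w //= _; rewrite tnth_set_coord eqxx.
  by have [s0 sC _] := sG; rewrite -(setD0 setT); exact: sC.
rewrite (_ : _ @^-1` _ = set0); first by have [] := sG.
by apply/seteqP; split=> w //=; rewrite tnth_set_coord eqxx.
Qed.

(** [I] factors through [theta], hence is G-measurable, and vanishes almost surely. It remains that
    h has integral 0 over each event of G; such an event does not constrain coordinate i_k, in which
    h is centered. *)
Lemma cond_expectation_centered :
  cond_expectation P G (fun w => h (VA w)) I /\ {ae P, forall w, I w = 0%E}.
Proof.
have mhA : measurable_fun setT (EFin \o (h \o subtuple A)).
  exact: (measurable_int _ ih).
have I0 : {ae P, forall w, I w = 0%E} := ae_law mV VQ h0.
have mVA : measurable_fun setT VA := measurableT_comp (@measurable_subtuple R n A) mV.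
have mI : measurable_fun setT I.
  rewrite (_ : I = J \o theta); last by apply/funext => w; rewrite I_theta.
  apply: (measurableT_comp mJ).
  exact: (measurableT_comp (@measurable_set_coord R _ k)
    (measurableT_comp (pair1_measurable (0 : R)) mVA)).
split=> //; split.
- exact: (integrable_law mV VQ mhA).1.
- apply/integrableP; split=> //.
  rewrite (ae_eq_integral (cst 0%E)) ?integral0//.
    exact: measurableT_comp.
  by apply: filterS I0 => w -> _; rewrite abse0.
- move=> B mB; rewrite (_ : I @^-1` B = theta @^-1` (J @^-1` B)).
    by apply: preimage_theta; rewrite -[X in measurable X]setTI; exact: mJ.
  by apply/seteqP; split=> w /=; rewrite I_theta.
- move=> _ /generators_sub[D mD <-]; rewrite setTI.
  pose D' := (fun t => set_coord (subtuple A t) k 0) @^-1` D.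
  have mD' : measurable D'.
    rewrite -[X in measurable X]setTI.
    apply: (measurableT_comp (@measurable_set_coord R _ k)
      (measurableT_comp (pair1_measurable (0 : R)) (@measurable_subtuple R n A))) => //.
  have mE : measurable (theta @^-1` D).
    rewrite -[X in measurable X]setTI.
    exact: (measurableT_comp (@measurable_set_coord R _ k)
      (measurableT_comp (pair1_measurable (0 : R)) mVA)).
  rewrite (ae_eq_integral (cst 0%E)) ?integral0//; last first.
    by apply: filterS I0 => w -> _.
    exact: measurable_funTS.
  rewrite integral_mkcond.
  have ihD : Q.-integrable setT ((EFin \o (h \o subtuple A)) \_ D').
    by apply/(integrable_mkcond _ mD'); exact: integrableS ih.
  rewrite -(integral_law mV VQ ihD) -integral_mkcond; apply: esym.
  apply: (integral_centered hQ (i := enum_val k) mD') ih _.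
    move=> t x; rewrite /D' /= subtuple_set_coord set_coord_set_coord//.
  have aeQ := ae_filter_ringOfSetsType Q.
  by apply: filterS h0 => t; under eq_integral do rewrite -subtuple_set_coord.
Qed.

End conditioning.

(** * The density of a copula, restricted to the cube *)

Section copula_density.
Context (R : realType) (n : nat) d (T : measurableType d) (P : probability T R).
Variables (X : 'I_n -> {RV P >-> R}) (C f : n.-tuple R -> R).
Hypotheses (hX : copula_vector X C) (hf : joint_density X f).

Let ae_cube : {ae P, forall w, unit_cube R n (joint X w)}.
Proof.
have m01 : measurable (~` `[0, 1]%classic : set R).
  by apply: measurableC; exact: measurable_itv.
have : {ae P, forall w, forall i, 0 <= X i w <= 1}.
  apply: filter_forall => i; exists (X i @^-1` ~` `[0, 1]%classic); split.
  - by rewrite -[X in measurable X]setTI; exact: measurable_funP.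
  - rewrite -[LHS]/(distribution P (X i) (~` `[0, 1]%classic)) hX.1//.
    by apply: etrans (uniform_prob01E m01) _; rewrite setICl measure0.
  - by move=> w /= h; apply: contra_not h; rewrite /= in_itv.
by apply: filterS => w h i; rewrite tnth_mktuple.
Qed.

(** Nothing forces f to vanish pointwise outside the cube, but X lies in the cube almost surely, its
    coordinates being uniform. *)
Lemma integral_density_cube (D : set (n.-tuple R)) : measurable D ->
  (\int[lebesgue_tuple R n]_(t in D `&` unit_cube R n) (f t)%:E =
   P (joint X @^-1` D))%E.
Proof.
have [_ _ fE] := hf; move=> mD; have mC := @measurable_unit_cube R n.
have mj B : measurable B -> measurable (joint X @^-1` B).
  by move=> mB; rewrite -[X in measurable X]setTI; exact: measurable_joint.
rewrite -fE; last exact: measurableI.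
have := ae_cube; move=> [N [mN N0 subN]].
rewrite preimage_setI; apply/eqP; rewrite eq_le; apply/andP; split.
  by apply: le_measure; rewrite ?inE; [apply: measurableI|..]; try exact: mj.
apply: (@le_trans _ _ (P ((joint X @^-1` D `&` joint X @^-1` unit_cube R n) `|` N))).
  apply: le_measure; rewrite ?inE; first exact: mj.
    by apply: measurableU => //; apply: measurableI; exact: mj.
  move=> w Dw; have [wC|wC] := pselect (unit_cube R n (joint X w)); first by left.
  by right; apply: subN.
have N0' : (P N <= 0)%E by rewrite N0.
apply: (le_trans (measureU2 _ _ _)) => //.
  by apply: measurableI; exact: mj.
by apply: le_trans (leeD (lexx _) N0') _; rewrite adde0.
Qed.

Lemma density_coord (i : 'I_n) (B : set R) : measurable B ->
  (\int[lebesgue_tuple R n]_(t in ((fun t => tnth t i) @^-1` B) `&` unit_cube R n)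
     (f t)%:E = @uniform01_prob R B)%E.
Proof.
move=> mB; rewrite integral_density_cube; last first.
  by rewrite -[X in measurable X]setTI; exact: (@measurable_tnth _ _ n i).
rewrite (_ : _ @^-1` _ = X i @^-1` B); first exact: hX.1.
by apply/seteqP; split=> w /=; rewrite tnth_mktuple.
Qed.

Lemma copula_density_integral u : unit_cube R n u ->
  (C u)%:E = (\int[lebesgue_tuple R n]_(t in box0 u) (f t)%:E)%E.
Proof.
move=> hu; rewrite hX.2//.
pose L : set (n.-tuple R) := box (fun i => `]-oo, tnth u i]%classic).
have mL : measurable L by apply: measurable_box => i; exact: measurable_itv.
rewrite (_ : box0 u = L `&` unit_cube R n).
  rewrite integral_density_cube//; congr (P _); apply/seteqP; split=> w /= h i.
    by rewrite /= in_itv/= tnth_mktuple.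
  by have := h i; rewrite /= in_itv/= tnth_mktuple.
apply/seteqP; split=> t /=.
  move=> h; split=> i; have /andP[t0 tu] := h i; first by rewrite /= in_itv.
  by rewrite t0 (le_trans tu)//; have /andP[] := hu i.
move=> [hL hC] i; have := hL i; rewrite /= in_itv/= => ->; rewrite andbT.
by have /andP[] := hC i.
Qed.

End copula_density.

Unset Implicit Arguments.

Theorem theorem3p2 (R : realType) (n : nat) (hn : (2 <= n)%N)
    (d : measure_display) (T : measurableType d) (P : probability T R)
    (V : 'I_n -> {RV P >-> R})
    (hVunif : forall i, uniform01 (V i))
    (hVindep : mutually_independent V)
    (C : n.-tuple R -> R)
    (hC : forall u, unit_cube R n u -> 0 <= C u <= 1) :
  absolutely_continuous_copula C <->
  exists g : forall A : {set 'I_n}, #|A|.-tuple R -> R,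
    [/\ forall A : {set 'I_n}, (2 <= #|A|)%N ->
          measurable_fun setT (g A),
        forall A : {set 'I_n}, (2 <= #|A|)%N ->
          (\int[lebesgue_tuple R #|A|]_(t in unit_cube R #|A|) `|(g A t)%:E|
             < +oo)%E,
        forall (A : {set 'I_n}) (k : 'I_#|A|), (2 <= #|A|)%N ->
          let VA w := subtuple A (joint V w) in
          let I w := (\int[lebesgue_measure]_(x in `[0%R, 1%R])
                        (g A (set_coord (VA w) k x))%:E)%E in
          cond_expectation P
            (g_sigma_preimage
               (fun j : 'I_#|A|.-1 => V (enum_val (lift k j)) : T -> R))
            (fun w => g A (VA w)) I
          /\ {ae P, forall w, I w = 0%E},
        {ae P, forall w, -1 <= U_tilde g (joint V w)} &
        forall u, unit_cube R n u ->
          (C u)%:E =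
          (\int[lebesgue_tuple R n]_(t in box0 u) (1 + U_tilde g t)%:E)%E].
Proof.
have n0 : (0 < n)%N by exact: ltnW.
pose Q : probability (n.-tuple R) R := distribution P (MeasurableFun.Pack
  (MeasurableFun.Class (isMeasurableFun.Build _ _ _ _ _ (measurable_joint V)))).
have VQ : has_law P (joint V) Q by [].
have mV := measurable_joint V.
have hQ : uniform_on_cube Q := uniform_on_cube_joint hVunif hVindep VQ.
split=> [[d' [T' [P' [X [f [hX hf _]]]]]]|[g [mg ig hg gN1 Cg]]].
- have [mf f0 _] := hf.
  have mEf : measurable_fun setT (EFin \o f) by exact/measurable_EFinP.
  have f_coord (i : 'I_n) (B : set R) : measurable B ->
      (\int[Q]_(t in (fun t => tnth t i) @^-1` B) (f t)%:E = uniform01_prob B)%E.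
    move=> mB; rewrite (integral_uniform_on_cube hQ)//.
      exact: density_coord hX hf _ _ mB.
    by rewrite -[X in measurable X]setTI; exact: (@measurable_tnth _ _ n i).
  pose g (A : {set 'I_n}) := @hoeffding_term R n Q f A.
  have mg A : measurable_fun setT (g A) by exact: measurable_hoeffding_term.
  have gE A t : g A (subtuple A t) = hoeffding Q f A t.
    exact: hoeffding_term_subtuple.
  have ig A : Q.-integrable setT (EFin \o (g A \o subtuple A)).
    rewrite (_ : EFin \o _ = EFin \o hoeffding Q f A).
      exact: integrable_hoeffding.
    by apply/funext => t /=; rewrite gE.
  have aeU : {ae Q, forall t, 1 + U_tilde g t = f t}.
    have aeQ := ae_filter_ringOfSetsType Q.
    apply: filterS (ae_sum_hoeffding_ge2 hQ f0 mf f_coord n0) => t <-.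
    by congr (_ + _); apply: eq_bigr => A _; exact: gE.
  exists g; split.
  + by move=> A _; exact: mg.
  + by move=> A _; apply/(integrable_subtuple hQ (mg A)); exact: ig.
  + move=> A k _ VA I.
    apply: (cond_expectation_centered (k := k) VQ hQ (mg A) (ig A)).
    have aeQ := ae_filter_ringOfSetsType Q.
    apply: filterS (ae_hoeffding_centered hQ f0 mf f_coord n0 (enum_valP k)) => t.
    by under eq_integral do rewrite -gE subtuple_set_coord.
  + apply: (ae_law mV VQ (p := fun t => -1 <= U_tilde g t)).
    have aeQ := ae_filter_ringOfSetsType Q.
    apply: filterS aeU => t tE; have := f0 t.
    by rewrite -tE -lerBlDl sub0r.
  + move=> u hu; rewrite (copula_density_integral hX hf hu).
    have uC : box0 u `&` unit_cube R n = box0 u.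
      rewrite setIidl// => t ht i; have /andP[-> tu] := ht i.
      by have /andP[_] := hu i; exact: le_trans.
    have mU : measurable_fun setT (U_tilde g) by apply: measurable_U_tilde.
    (* The two integrands are known to agree Q-almost everywhere, so both Lebesgue integrals are
       rewritten as integrals against Q. *)
    rewrite -uC -!(integral_uniform_on_cube hQ (measurable_box0 u))//; last first.
      by apply/measurable_EFinP/measurable_funD.
    apply: ae_eq_integral.
    * exact: measurable_box0.
    * exact: measurable_funTS.
    * by apply: measurable_funTS; apply/measurable_EFinP/measurable_funD.
    * have aeQ := ae_filter_ringOfSetsType Q.
      by apply: filterS aeU => t <- _.
- have mU := measurable_U_tilde mg.
  apply: (copula_of_U_tilde hQ mg _ _ _ n0 Cg).
  + move=> A A2; exact: (integrable_subtuple hQ (mg A A2)).1 (ig A A2).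
  + move=> A k A2; have [_ I0] := hg A k A2.
    have mgA : measurable_fun setT (EFin \o (g A \o subtuple A)).
      apply/measurable_EFinP.
      exact: (measurableT_comp (mg A A2) (@measurable_subtuple R n A)).
    have iA := (integrable_subtuple hQ (mg A A2)).1 (ig A A2).
    (* The return from P to Q needs a measurable event; here it is the zero set of the inner
       integral. *)
    have mI := measurable_resample hQ (enum_val k) iA.
    apply: (ae_law_inv mV VQ) I0.
    have := mI measurableT [set 0%E] (emeasurable_set1 _); rewrite setTI.
    congr (measurable _); apply/funext => t; congr (_ = 0%E).
    by apply: eq_integral => x _; rewrite /= subtuple_set_coord.
  + apply: (ae_law_inv mV VQ) gN1.
    rewrite -[X in measurable X]setTI.
    have mle : measurable_fun setT (fun t => -1 <= U_tilde g t).
      by apply: measurable_fun_ler.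
    exact: (mle measurableT [set true]).
Qed.
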